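(* Let $p$ be a positive even integer. There exists a constant $A_p>0$ depending only on $p$ such that for all integers $n\ge 1$ and all $r\in[0,1)$, $$\frac{1}{32^{1/p}}\left(\frac{n}{1-r}\right)^{1/p}\le C_{n,r}\left(H^p,H^\infty\right)\le A_p\left(\frac{n}{1-r}\right)^{1/p}.$$ Moreover, the upper bound holds for every real $p$ with $1\le p\le+\infty$: for each such $p$ there is a constant $A_p>0$ depending only on $p$ such that $C_{n,r}(H^p,H^\infty)\le A_p\left(\frac{n}{1-r}\right)^{1/p}$ for all $n\ge1$ and $r\in[0,1)$ (with $1/p=0$ if $p=+\infty$).
   Context: $\mathbb{D}=\{z\in\mathbb{C}:|z|<1\}$, $\mathrm{Hol}(\mathbb{D})$ is the space of holomorphic functions on $\mathbb{D}$, and $H^p=H^p(\mathbb{D})$ ($1\le p\le\infty$) are the standard Hardy spaces of the disc with their usual norms; $H^\infty$ has norm $\|f\|_\infty=\sup_{z\in\mathbb{D}}|f(z)|$. A finite set $\sigma=\{\lambda_1,\dots,\lambda_n\}\subset\mathbb{D}$ is understood as a finite family in which points may be repeated; $\#\sigma$ counts multiplicities. Put $B=\prod_{i=1}^n b_{\lambda_i}$ with $b_\lambda(z)=\frac{\lambda-z}{1-\overline{\lambda}z}$. For $f,g\in\mathrm{Hol}(\mathbb{D})$, the condition $g_{|\sigma}=f_{|\sigma}$ means $f-g\in B\,\mathrm{Hol}(\mathbb{D})$ (interpolation counted with multiplicity). For Banach spaces $X\supset Y$ of holomorphic functions on $\mathbb{D}$, $$c(\sigma,X,Y)=\sup_{f\in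 X,\ \|f\|_X\le1}\ \inf\{\|g\|_Y:\ g\in Y,\ g_{|\sigma}=f_{|\sigma}\},$$ and for an integer $n\ge1$ and $r\in[0,1)$, $$C_{n,r}(X,Y)=\sup\{c(\sigma,X,Y):\ \#\sigma\le n,\ |\lambda|\le r\ \text{for all }\lambda\in\sigma\}.$$ *)

(* Defs.v *)
From HB Require Import structures.
From mathcomp Require Import all_boot all_order all_algebra.
From mathcomp Require Import all_classical all_reals all_analysis.
From mathcomp Require Import complex.

Set Implicit Arguments.
Unset Strict Implicit.
Unset Printing Implicit Defensive.

Import Order.TTheory GRing.Theory Num.Theory.
Import numFieldNormedType.Exports.

Local Open Scope classical_set_scope.
Local Open Scope ring_scope.

(* The modulus of a complex number, as a real number. *)
Notation cmod := ComplexField.Normc.normc.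

Definition disc (R : realType) : set R[i] := [set z | cmod z < 1].

(* Holomorphic functions on the disc are represented by total functions;
   their values outside the disc are never used. The limit of difference
   quotients is taken over the field R[i], i.e. it is the complex derivative. *)
Definition Hol (R : realType) : set (R[i] -> R[i]) :=
  [set f | forall z : R[i], disc z -> derivable (f : R[i]^o -> R[i]^o) z 1].

Record holSpace (R : realType) := HolSpace {
  carrier : set (R[i] -> R[i]);
  hnorm : (R[i] -> R[i]) -> \bar R }.

(* For p < +oo:
   sup_(0 <= rho < 1) (1/(2 pi) int_0^(2 pi) |f(rho e^(it))|^p dt)^(1/p). *)
Definition hardy_norm (R : realType) (p : \bar R) (f : R[i] -> R[i]) : \bar R :=
  match p with
  | q%:E => ereal_sup [set
      poweR ((2 * pi)^-1%:E *
         \int[@lebesgue_measure R]_(t in `[0%R, (2 * pi)%R]%classic)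
           (cmod (f (Complex (rho * cos t) (rho * sin t))) `^ q)%:E)%E q^-1
      | rho in [set rho : R | 0 <= rho < 1]]
  | _ => ereal_sup [set (cmod (f z))%:E | z in @disc R]
  end.

Definition Hardy (R : realType) (p : \bar R) : holSpace R :=
  HolSpace [set f | Hol f /\ (hardy_norm p f < +oo)%E] (hardy_norm p).

Definition blaschke_factor (R : realType) (l z : R[i]) : R[i] :=
  (l - z) / (1 - (l^*)%C * z).

Definition blaschke (R : realType) (sigma : seq R[i]) (z : R[i]) : R[i] :=
  \prod_(l <- sigma) blaschke_factor l z.

(* g = f on sigma, with multiplicities: f - g \in B Hol(D). *)
Definition agree_on (R : realType) (sigma : seq R[i]) (g f : R[i] -> R[i]) :=
  exists2 h, Hol h &
    forall z : R[i], disc z -> f z - g z = blaschke sigma z * h z.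

(* The infimum of the empty set is +oo. *)
Definition interp_const (R : realType) (sigma : seq R[i]) (X Y : holSpace R) :
    \bar R :=
  ereal_sup [set
    ereal_inf [set hnorm Y g | g in [set g | carrier Y g /\ agree_on sigma g f]]
    | f in [set f | carrier X f /\ (hnorm X f <= 1)%E]].

Definition Cnr (R : realType) (n : nat) (r : R) (X Y : holSpace R) : \bar R :=
  ereal_sup [set interp_const sigma X Y
    | sigma in [set sigma : seq R[i] |
        (size sigma <= n)%N /\ forall l, l \in sigma -> cmod l <= r]].

(* Main.v *)
Require Import Defs.
From HB Require Import structures.
From mathcomp Require Import all_boot all_order all_algebra.
From mathcomp Require Import all_classical all_reals all_analysis.
From mathcomp Require Import complex.
From mathcomp Require Import ring lra.

Set Implicit Arguments.
Unset Strict Implicit.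
Unset Printing Implicit Defensive.

Import Order.TTheory GRing.Theory Num.Theory.
Import numFieldNormedType.Exports.

(* Upper bound. Put rho = 1 - (1 - r)/(8n). On the circle |w| = rho a function of the unit ball
   of H^p is O((n/(1-r))^(1/p)), while |B| >= 1/2 there. Let F = f/B, with analytic part F+ in
   the annulus r < |z| < 1. The function h(z) = F+(z) - rho^2 F+(rho^2 z) is holomorphic in the
   disc, and outside |z| = rho the interpolant g = f - B h equals minus B(z) times the mean over
   |w| = rho of
     F(w) w^2 (1 - rho^2) / ((w - z)(w - rho^2 z)),
   whose kernel is comparable to a Poisson kernel as |z| -> 1. Hence |g| <= C max_{|w|=rho} |F|.

   Lower bound. Take sigma = {-r, ..., -r} (n times), b = b_{-r} and p = 2m. The function
   f0 = (1 - b^n)/(1 + z) has an m-th root F, and the mean of |F|^p = |f0|^2 is O(n/(1-r)). If g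
   interpolates F then g^m interpolates f0; since (1 - r) f0(b(z)) = (1 + rz)(1 + ... + z^(n-1)),
   integrating g^m o b against the Fejer kernel gives |g|^m >= n(1+r)/(2(1-r)) somewhere.

   Complex analysis on the disc (Goursat, Cauchy and Poisson formulas) is derived from complex
   differentiability alone, through means over circles centred at the origin. *)

(** Functions of H^p are only evaluated on circles of radius below 1, so boundary values and duality
    never enter. The radius rho balances two demands. Each factor of B satisfies 1 - |b|^2 <= 4(1 -
    rho)/(1 - r) = 1/(2n), so n factors cost at most 1/2 in |B|^2; and 1/(1 - rho) = 8n/(1 - r), so
    the growth of H^p costs no more than the bound sought. The correction rho^2 F+(rho^2 z) is the
    decisive device: F+ alone would leave a Cauchy kernel, whose mean modulus over |w| = rho is of
    order log(1/(1 - rho)) for z near the unit circle. The constant is 330 = 5 * 2 * 33 for every p: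
    5 from the corrected kernel, 2 from 1/|B|, 33 from the growth estimate. In the lower bound, p =
    2m makes g^m holomorphic, makes F - g a factor of F^m - g^m, and turns |F|^p into a square. With
    N = n(1 + r)/(1 - r), the mean of |f0|^2 is at most 8N and |g|^m reaches N/2, so normalising
    gives (N/2)^2/(8N) = N/32, whence 32. *)

Local Open Scope classical_set_scope.
Local Open Scope complex_scope.
Local Open Scope ring_scope.

(** * Modulus and real integrals *)

#[global] Arguments ComplexField.Normc.normc : simpl never.

Section Modulus.
Context (R : realType).
Implicit Types (x y z w : R[i]) (a b : R).

Lemma cmodE z : cmod z = Num.sqrt (complex.Re z ^+ 2 + complex.Im z ^+ 2).
Proof. by case: z. Qed.

Lemma normC_cmod z : `|z| = (cmod z)%:C.
Proof. by rewrite normc_def cmodE. Qed.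

Lemma cmod_ge0 z : 0 <= cmod z.
Proof. by rewrite cmodE sqrtr_ge0. Qed.

Lemma cmodM x y : cmod (x * y) = cmod x * cmod y.
Proof. exact: ComplexField.Normc.normcM. Qed.

Lemma cmodV x : cmod x^-1 = (cmod x)^-1.
Proof. exact: ComplexField.Normc.normcV. Qed.

Lemma cmodN x : cmod (- x) = cmod x.
Proof. exact: normcN. Qed.

Lemma cmodD x y : cmod (x + y) <= cmod x + cmod y.
Proof. exact: le_normcD. Qed.

Lemma cmodB x y : cmod (x - y) <= cmod x + cmod y.
Proof. by rewrite (le_trans (cmodD _ _))// cmodN. Qed.

Lemma cmodC x y : cmod (x - y) = cmod (y - x).
Proof. by rewrite -cmodN opprB. Qed.

Lemma cmod0 : cmod (0 : R[i]) = 0.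
Proof. exact: ComplexField.Normc.normc0. Qed.

Lemma cmod1 : cmod (1 : R[i]) = 1.
Proof. exact: ComplexField.Normc.normc1. Qed.

Lemma cmod_eq0 z : (cmod z == 0) = (z == 0).
Proof.
by apply/eqP/eqP => [/ComplexField.Normc.eq0_normc//|->]; rewrite cmod0.
Qed.

Lemma cmod_gt0 z : (0 < cmod z) = (z != 0).
Proof. by rewrite lt_def cmod_ge0 andbT cmod_eq0. Qed.

Lemma cmodX z n : cmod (z ^+ n) = cmod z ^+ n.
Proof. by elim: n => [|n IH]; rewrite ?expr0 ?cmod1// !exprS cmodM IH. Qed.

Lemma cmod_real a : cmod a%:C = `|a|.
Proof. by rewrite cmodE /= expr0n addr0 sqrtr_sqr. Qed.

Lemma cmodJ z : cmod (z^*)%C = cmod z.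
Proof. by rewrite !cmodE; case: z => a b /=; rewrite sqrrN. Qed.

Lemma sqr_cmod z : cmod z ^+ 2 = complex.Re z ^+ 2 + complex.Im z ^+ 2.
Proof. by rewrite cmodE sqr_sqrtr// addr_ge0 ?sqr_ge0. Qed.

Lemma mulcJ z : z * (z^*)%C = (cmod z ^+ 2)%:C.
Proof.
rewrite sqr_cmod; case: z => a b /=; apply/eqP; rewrite eq_complex /=.
by apply/andP; split; apply/eqP; ring.
Qed.

Lemma Re_le_cmod z : `|complex.Re z| <= cmod z.
Proof.
by rewrite -(@ler_pXn2r _ 2) ?nnegrE ?cmod_ge0// sqr_cmod real_normK ?num_real// lerDl sqr_ge0.
Qed.

Lemma Im_le_cmod z : `|complex.Im z| <= cmod z.
Proof.
by rewrite -(@ler_pXn2r _ 2) ?nnegrE ?cmod_ge0// sqr_cmod real_normK ?num_real// lerDr sqr_ge0.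
Qed.

Lemma cmod_le_ReIm z : cmod z <= `|complex.Re z| + `|complex.Im z|.
Proof.
rewrite -(@ler_pXn2r _ 2) ?nnegrE ?cmod_ge0 ?addr_ge0// sqr_cmod sqrrD.
rewrite !real_normK ?num_real// [leRHS]addrAC lerDl.
by rewrite mulrn_wge0// mulr_ge0.
Qed.

Lemma cmodBD x y z : cmod (x - z) <= cmod (x - y) + cmod (y - z).
Proof. by rewrite -[x - z](subrKA y) addrC -[in leRHS](addrC (cmod (y - z))) cmodD. Qed.

Lemma ler_cmodB x y : cmod x - cmod y <= cmod (x - y).
Proof. by rewrite lerBlDr -{1}(subrK y x) cmodD. Qed.

Lemma ler_dist_cmod x y : `|cmod x - cmod y| <= cmod (x - y).
Proof. by rewrite ler_norml ler_cmodB andbT lerNl opprB cmodC ler_cmodB. Qed.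

Lemma ReZ a z : complex.Re (a%:C * z) = a * complex.Re z.
Proof. by case: z => x y /=; rewrite mul0r subr0. Qed.

Lemma ReD x y : complex.Re (x + y) = complex.Re x + complex.Re y.
Proof. by case: x; case: y. Qed.
Lemma ImD x y : complex.Im (x + y) = complex.Im x + complex.Im y.
Proof. by case: x; case: y. Qed.
Lemma ReN x : complex.Re (- x) = - complex.Re x.
Proof. by case: x. Qed.
Lemma ImN x : complex.Im (- x) = - complex.Im x.
Proof. by case: x. Qed.
Lemma ReM x y : complex.Re (x * y) =
  complex.Re x * complex.Re y - complex.Im x * complex.Im y.
Proof. by case: x; case: y. Qed.
Lemma ImM x y : complex.Im (x * y) =
  complex.Re x * complex.Im y + complex.Im x * complex.Re y.
Proof. by case: x; case: y. Qed.

End Modulus.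

Section RealIntegral.
Context (R : realType).
Notation mu := (@lebesgue_measure R).
Implicit Types (a b c k m : R) (u v : R -> R).

(** Continuity is asked in a full neighbourhood of each point, endpoints included; the integrands
    below are defined on the whole line. *)
Definition ctnR a b u := forall t, a <= t <= b -> {for t, continuous u}.

Definition Ri a b u : R := \int[mu]_(t in `[a, b]) u t.

Lemma ctnR_integrable a b u : ctnR a b u -> mu.-integrable `[a, b] (EFin \o u).
Proof.
move=> h; apply: continuous_compact_integrable; first exact: segment_compact.
by apply: continuous_in_subspaceT => t; rewrite inE/= in_itv/= => /h.
Qed.

Lemma eq_Ri a b u v : (forall t, a <= t <= b -> u t = v t) -> Ri a b u = Ri a b v.
Proof. by move=> h; apply: eq_Rintegral => t; rewrite inE/= in_itv/= => /h. Qed.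

Lemma RiD a b u v : ctnR a b u -> ctnR a b v ->
  Ri a b (fun t => u t + v t) = Ri a b u + Ri a b v.
Proof. by move=> hu hv; rewrite /Ri RintegralD//; exact: ctnR_integrable. Qed.

Lemma RiZ a b k u : ctnR a b u -> Ri a b (fun t => k * u t) = k * Ri a b u.
Proof. by move=> hu; rewrite /Ri RintegralZl//; exact: ctnR_integrable. Qed.

Lemma RiN a b u : ctnR a b u -> Ri a b (fun t => - u t) = - Ri a b u.
Proof. by move=> hu; rewrite -mulN1r -RiZ//; apply: eq_Ri => t _; rewrite mulN1r. Qed.

Lemma le_Ri a b u v : ctnR a b u -> ctnR a b v ->
  (forall t, a <= t <= b -> u t <= v t) -> Ri a b u <= Ri a b v.
Proof.
move=> hu hv h; apply: le_Rintegral => //; exact: ctnR_integrable.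
Qed.

Lemma Ri_ge0 a b u : (forall t, a <= t <= b -> 0 <= u t) -> 0 <= Ri a b u.
Proof. by move=> h; apply: Rintegral_ge0 => t /=; rewrite in_itv/= => /h. Qed.

Lemma Ri_cst a b k : a <= b -> Ri a b (fun=> k) = k * (b - a).
Proof.
move=> ab; rewrite /Ri Rintegral_cst//.
rewrite [X in fine X](_ : _ = (b - a)%:E)//.
apply: (eq_trans (lebesgue_measure_itv `[a, b])); rewrite /= lte_fin.
by have [//|ba] := ltP a b; rewrite (@le_anti _ _ a b) ?ab// subrr.
Qed.

Lemma Ri_cat a b c u : a <= b -> b <= c -> ctnR a c u ->
  Ri a c u = Ri a b u + Ri b c u.
Proof.
move=> ab bc hu; have hi := ctnR_integrable hu.
rewrite /Ri -(@Rintegral_itv_obnd_cbnd _ b); last first.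
  apply: integrableS hi => //; apply: subset_itvr; rewrite bnd_simp//.
rewrite -(@Rintegral_itvB _ u (BLeft a) (BRight c) b)//.
by rewrite addrC subrK.
Qed.

End RealIntegral.

(** * Integrals of complex-valued functions on an interval *)

Section ComplexIntegral.
Context (R : realType).
Implicit Types (a b c k m t : R) (F G : R -> R[i]) (z w : R[i]).

(** Real radii and [cmod] are used because the norm of [R[i]] takes its values in [R[i]]; [ctn_ReIm]
    links this form to the topology of [R]. *)
Definition ctn F t := forall e : R, 0 < e -> exists2 d : R, 0 < d &
  forall s, `|s - t| < d -> cmod (F s - F t) < e.

Definition ctnC a b F := forall t, a <= t <= b -> ctn F t.

Lemma continuous_dist (u : R -> R) t : {for t, continuous u} <->
  forall e, 0 < e -> exists2 d : R, 0 < d & forall s, `|s - t| < d -> `|u s - u t| < e.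
Proof.
split.
  move=> /cvgrPdist_lt h e /h /nbhs_ballP[d /= d0 hd]; exists d => // s st.
  by rewrite distrC; apply: hd; rewrite /ball/= distrC.
move=> h; apply/cvgrPdist_lt => e /h[d d0 hd]; apply/nbhs_ballP; exists d => //= s.
by rewrite /ball/= distrC => /hd; rewrite distrC.
Qed.

Lemma ctn_ReIm F t : ctn F t <-> {for t, continuous (fun s => complex.Re (F s))}
  /\ {for t, continuous (fun s => complex.Im (F s))}.
Proof.
split.
  move=> h; split; apply/continuous_dist => e /h[d d0 hd]; exists d => // s /hd.
    by apply: le_lt_trans; rewrite (le_trans _ (Re_le_cmod _))// ReD ReN.
  by apply: le_lt_trans; rewrite (le_trans _ (Im_le_cmod _))// ImD ImN.
move=> [/continuous_dist h1 /continuous_dist h2] e e0.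
have e2 : 0 < e / 2 by lra.
have [d1 d10 hd1] := h1 _ e2; have [d2 d20 hd2] := h2 _ e2.
exists (Num.min d1 d2); first by rewrite lt_min d10.
move=> s; rewrite lt_min => /andP[/hd1 s1 /hd2 s2].
rewrite (le_lt_trans (cmod_le_ReIm _))// ReD ImD ReN ImN; lra.
Qed.

Lemma ctn_cmod F t : ctn F t -> {for t, continuous (fun s => cmod (F s))}.
Proof.
move=> h; apply/continuous_dist => e /h[d d0 hd]; exists d => // s /hd.
exact/le_lt_trans/ler_dist_cmod.
Qed.

Lemma ctnD F G t : ctn F t -> ctn G t -> ctn (fun s => F s + G s) t.
Proof.
move=> hF hG e e0; have e2 : 0 < e / 2 by lra.
have [d1 d10 hd1] := hF _ e2; have [d2 d20 hd2] := hG _ e2.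
exists (Num.min d1 d2); first by rewrite lt_min d10.
move=> s; rewrite lt_min => /andP[/hd1 s1 /hd2 s2].
rewrite (_ : _ - _ = (F s - F t) + (G s - G t)); last by rewrite opprD addrACA.
rewrite (le_lt_trans (cmodD _ _))//; lra.
Qed.

Lemma ctnZ z F t : ctn F t -> ctn (fun s => z * F s) t.
Proof.
move=> hF e e0; have z1 : 0 < cmod z + 1 by rewrite ltr_wpDl// cmod_ge0.
have [d d0 hd] := hF _ (divr_gt0 e0 z1); exists d => // s /hd sd.
rewrite -mulrBr cmodM (@le_lt_trans _ _ ((cmod z + 1) * cmod (F s - F t)))//.
  by rewrite ler_wpM2r ?cmod_ge0// lerDl.
by rewrite mulrC -ltr_pdivlMr.
Qed.

Lemma ctnN F t : ctn F t -> ctn (fun s => - F s) t.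
Proof.
by move=> /(ctnZ (-1)) h e /h[d d0 hd]; exists d => // s /hd; rewrite !mulN1r.
Qed.

Lemma ctn_cst z t : ctn (fun=> z) t.
Proof. by move=> e e0; exists 1 => // s _; rewrite subrr cmod0. Qed.

Definition cint a b F : R[i] :=
  Complex (Ri a b (fun t => complex.Re (F t))) (Ri a b (fun t => complex.Im (F t))).

Lemma ctnC_Re a b F : ctnC a b F -> ctnR a b (fun t => complex.Re (F t)).
Proof. by move=> h t /h /ctn_ReIm[]. Qed.
Lemma ctnC_Im a b F : ctnC a b F -> ctnR a b (fun t => complex.Im (F t)).
Proof. by move=> h t /h /ctn_ReIm[]. Qed.
Hint Resolve ctnC_Re ctnC_Im : core.

Lemma eq_cint a b F G : (forall t, a <= t <= b -> F t = G t) -> cint a b F = cint a b G.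
Proof. by move=> h; congr Complex; apply: eq_Ri => t /h ->. Qed.

Lemma cintD a b F G : ctnC a b F -> ctnC a b G ->
  cint a b (fun t => F t + G t) = cint a b F + cint a b G.
Proof.
move=> hF hG; apply/eqP; rewrite eq_complex /=; apply/andP; split; apply/eqP.
  by rewrite -RiD; auto; apply: eq_Ri => t _; rewrite ReD.
by rewrite -RiD; auto; apply: eq_Ri => t _; rewrite ImD.
Qed.

Lemma cintZ a b z F : ctnC a b F -> cint a b (fun t => z * F t) = z * cint a b F.
Proof.
move=> hF; have hr k u : ctnR a b u -> ctnR a b (fun t => k * u t).
  by move=> hu t /hu ht; apply: cvgM => //; exact: cvg_cst.
apply/eqP; rewrite eq_complex; apply/andP; split; apply/eqP.
  rewrite ReM /= -!RiZ; auto; rewrite -RiN; auto; rewrite -RiD; auto.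
    by apply: eq_Ri => t _; rewrite ReM.
  by move=> t tab; apply: cvgN; apply: hr; auto.
rewrite ImM /= -!RiZ; auto; rewrite -RiD; auto.
by apply: eq_Ri => t _; rewrite ImM.
Qed.

Lemma cintN a b F : ctnC a b F -> cint a b (fun t => - F t) = - cint a b F.
Proof. by move=> hF; rewrite -mulN1r -cintZ//; apply: eq_cint => t _; rewrite mulN1r. Qed.

Lemma cintB a b F G : ctnC a b F -> ctnC a b G ->
  cint a b (fun t => F t - G t) = cint a b F - cint a b G.
Proof. by move=> hF hG; rewrite cintD ?cintN// => t /hG; exact: ctnN. Qed.

Lemma cint_cst a b z : a <= b -> cint a b (fun=> z) = (b - a)%:C * z.
Proof.
move=> ab; rewrite /cint !Ri_cst//; case: z => x y.
by apply/eqP; rewrite eq_complex /= !mul0r subr0 addr0 mulrC eqxx mulrC eqxx.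
Qed.

Lemma cint_cat a b c F : a <= b -> b <= c -> ctnC a c F ->
  cint a c F = cint a b F + cint b c F.
Proof.
move=> ab bc hF; apply/eqP; rewrite eq_complex /=.
by apply/andP; split; apply/eqP; rewrite -Ri_cat; auto.
Qed.

(* Rotate the integral onto the positive real axis. *)
Lemma cmod_cint a b F : ctnC a b F -> cmod (cint a b F) <= Ri a b (fun t => cmod (F t)).
Proof.
move=> hF; have hc : ctnR a b (fun t => cmod (F t)) by move=> t /hF; exact: ctn_cmod.
have [->|I0] := eqVneq (cint a b F) 0; first by rewrite cmod0 Ri_ge0// => t _; exact: cmod_ge0.
pose u := ((cint a b F)^*)%C / (cmod (cint a b F))%:C.
have c0 : cmod (cint a b F) != 0 by rewrite cmod_eq0.
have u1 : cmod u = 1.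
  by rewrite cmodM cmodV cmodJ cmod_real ger0_norm ?cmod_ge0// divff.
have huF : ctnC a b (fun t => u * F t) by move=> t /hF; exact: ctnZ.
have -> : cmod (cint a b F) = complex.Re (u * cint a b F).
  rewrite /u -mulrA [_ * cint _ _ _]mulrC mulrA [X in X / _]mulrC mulcJ.
  by rewrite -fmorphV -rmorphM /= expr2 mulfK.
rewrite -cintZ//; apply: le_Ri; auto.
by move=> t tab; rewrite (le_trans (ler_norm _))// (le_trans (Re_le_cmod _))// cmodM u1 mul1r.
Qed.

Lemma cmod_cint_le a b F m : a <= b -> ctnC a b F ->
  (forall t, a <= t <= b -> cmod (F t) <= m) -> cmod (cint a b F) <= m * (b - a).
Proof.
move=> ab hF h; rewrite (le_trans (cmod_cint hF))// -Ri_cst//; apply: le_Ri => //.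
  by move=> t /hF; exact: ctn_cmod.
by move=> t _; exact: cvg_cst.
Qed.

End ComplexIntegral.

(** * Complex derivatives *)

Section ComplexDerivative.
Context (R : realType).
Implicit Types (f g : R[i] -> R[i]) (z w : R[i]).

Definition cdiff f z := derivable (f : R[i]^o -> R[i]^o) z 1.

(** This lets the complex radii of neighbourhoods in [R[i]] be read as positive real numbers. *)
Lemma gt0_complex (e : R[i]) : 0 < e -> e = (complex.Re e)%:C /\ 0 < complex.Re e.
Proof. by rewrite ltcE /= => /andP[/eqP im re]; split => //; case: e im re => a b /= ->. Qed.

(** The o(h) form with real constants, which includes h = 0. All hand-made derivatives ([cexp],
    [croot], the Cauchy transform) are obtained through it. *)
Lemma cdiffP f z : cdiff f z <-> exists d : R[i], forall e : R, 0 < e ->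
  exists2 r : R, 0 < r & forall h, cmod h < r -> cmod (f (z + h) - f z - d * h) <= e * cmod h.
Proof.
split.
  move=> /cvg_ex[/= d /cvgrPdist_lt hd]; exists d => e e0.
  have /hd : 0 < e%:C by rewrite ltcR.
  move=> /nbhs_ballP[s /= /gt0_complex[-> r0] hr]; exists (complex.Re s) => // h hh.
  have [->|h0] := eqVneq h 0; first by rewrite addr0 mulr0 subr0 subrr cmod0 mulr0.
  have := hr h; rewrite /ball/= sub0r normrN normC_cmod ltcR => /(_ hh h0).
  rewrite normC_cmod ltcR => /ltW; rewrite -[h *: 1]/(h * 1) mulr1.
  rewrite -[_ *: _]/(h^-1 * _) => hle.
  rewrite (_ : f _ - f z - _ = - h * (d - h^-1 * (f (h + z) - f z))).
    by rewrite cmodM cmodN mulrC ler_wpM2r ?cmod_ge0.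
  by rewrite [z + h]addrC; field.
move=> [d hd]; apply/cvg_ex; exists d; apply/cvgrPdist_lt => e /gt0_complex[-> e0] /=.
have /hd [r r0 hr] : 0 < complex.Re e / 2 by lra.
apply/nbhs_ballP; exists r%:C => /=; first by rewrite ltcR.
move=> h; rewrite /ball/= sub0r normrN normC_cmod ltcR => /hr hh h0.
rewrite normC_cmod ltcR -[h *: 1]/(h * 1) mulr1 -[_ *: _]/(h^-1 * _).
have hc : 0 < cmod h by rewrite cmod_gt0.
rewrite (_ : d - _ = - h^-1 * (f (z + h) - f z - d * h)).
  rewrite cmodM cmodN cmodV mulrC ltr_pdivrMr// (le_lt_trans hh)// ltr_pM2r//; lra.
by rewrite [z + h]addrC; field.
Qed.

Lemma cdiff_ctn f z : cdiff f z -> forall e : R, 0 < e -> exists2 r : R, 0 < r &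
  forall w, cmod (w - z) < r -> cmod (f w - f z) < e.
Proof.
move=> /cdiffP[d /(_ _ ltr01)[r r0 hr]] e e0.
pose k := cmod d + 2; have k0 : 0 < k by rewrite /k; have := cmod_ge0 d; lra.
exists (Num.min r (e / k)); first by rewrite lt_min r0 divr_gt0.
move=> w; rewrite lt_min => /andP[/hr]; rewrite [z + _]addrC subrK mul1r => h1.
rewrite ltr_pdivlMr// => h2.
have := cmodD (f w - f z - d * (w - z)) (d * (w - z)); rewrite subrK cmodM => h3.
rewrite (le_lt_trans h3)// (le_lt_trans _ h2)// /k.
by have := cmod_ge0 (w - z); lra.
Qed.

Lemma cdiff_near f g z (r : R) : 0 < r -> (forall w, cmod (w - z) < r -> f w = g w) ->
  cdiff f z -> cdiff g z.
Proof.
move=> r0 fg /cdiffP[d hd]; apply/cdiffP; exists d => e /hd[s s0 hs].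
exists (Num.min s r); first by rewrite lt_min s0.
move=> h; rewrite lt_min => /andP[/hs hh hr]; rewrite -(fg z) ?subrr ?cmod0//.
by rewrite -(fg (z + h))// addrC addKr.
Qed.

Lemma eq_cdiff f g z : f =1 g -> cdiff f z -> cdiff g z.
Proof. by move=> fg; apply: (@cdiff_near _ _ _ 1). Qed.

Lemma cdiff_cst w z : cdiff (fun=> w) z.
Proof. exact: derivable_cst. Qed.

Lemma cdiff_id z : cdiff id z.
Proof. exact: derivable_id. Qed.

Lemma cdiffD f g z : cdiff f z -> cdiff g z -> cdiff (fun w => f w + g w) z.
Proof. exact: derivableD. Qed.

Lemma cdiffB f g z : cdiff f z -> cdiff g z -> cdiff (fun w => f w - g w) z.
Proof. exact: derivableB. Qed.

Lemma cdiffM f g z : cdiff f z -> cdiff g z -> cdiff (fun w => f w * g w) z.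
Proof. exact: derivableM. Qed.

Lemma cdiffV f z : f z != 0 -> cdiff f z -> cdiff (fun w => (f w)^-1) z.
Proof. exact: derivableV. Qed.

Lemma cdiff_comp f g z : cdiff f z -> cdiff g (f z) -> cdiff (fun w => g (f w)) z.
Proof.
move=> hf hg.
have [hf' _] := derivable1_diffP (f : R[i]^o -> R[i]^o) z.
have [hg' _] := derivable1_diffP (g : R[i]^o -> R[i]^o) (f z).
have [_ h] := derivable1_diffP ((fun w => g (f w)) : R[i]^o -> R[i]^o) z.
apply: h; exact: (@differentiable_comp _ _ _ _ (f : R[i]^o -> R[i]^o)
  (g : R[i]^o -> R[i]^o) z (hf' hf) (hg' hg)).
Qed.

#[global] Opaque cdiff.

Lemma cdiffX f n z : cdiff f z -> cdiff (fun w => f w ^+ n) z.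
Proof.
move=> hf; elim: n => [|n IH]; first exact: cdiff_cst.
by apply: (@eq_cdiff (fun w => f w * f w ^+ n)); [move=> w; rewrite exprS|exact: (cdiffM hf IH)].
Qed.

Lemma cdiff_sum (I : Type) (s : seq I) (F : I -> R[i] -> R[i]) z :
  (forall i, cdiff (F i) z) -> cdiff (fun w => \sum_(i <- s) F i w) z.
Proof.
move=> hF; elim: s => [|i s IH].
  by apply: (@eq_cdiff (fun=> 0)); [move=> w; rewrite big_nil|exact: cdiff_cst].
apply: (@eq_cdiff (fun w => F i w + \sum_(j <- s) F j w)).
  by move=> w; rewrite big_cons.
exact: (cdiffD (hF i) IH).
Qed.

Lemma cdiff_prod (I : eqType) (s : seq I) (F : I -> R[i] -> R[i]) z :
  (forall i, i \in s -> cdiff (F i) z) -> cdiff (fun w => \prod_(i <- s) F i w) z.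
Proof.
elim: s => [|i s IH] hF.
  by apply: (@eq_cdiff (fun=> 1)); [move=> w; rewrite big_nil|exact: cdiff_cst].
apply: (@eq_cdiff (fun w => F i w * \prod_(j <- s) F j w)).
  by move=> w; rewrite big_cons.
apply: cdiffM; first by apply: hF; rewrite mem_head.
by apply: IH => j js; apply: hF; rewrite inE js orbT.
Qed.

Definition cexp z : R[i] :=
  (expR (complex.Re z))%:C * Complex (cos (complex.Im z)) (sin (complex.Im z)).

Lemma cexpD z w : cexp (z + w) = cexp z * cexp w.
Proof.
rewrite /cexp ReD ImD expRD rmorphM /= mulrACA; congr (_ * _).
rewrite cosD sinD; apply/eqP; rewrite eq_complex /=.
by apply/andP; split; apply/eqP; ring.
Qed.

Lemma cmod_cexp z : cmod (cexp z) = expR (complex.Re z).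
Proof.
rewrite cmodM cmod_real ger0_norm ?expR_ge0// [cmod (Complex _ _)]cmodE /=.
by rewrite cos2Dsin2 sqrtr1 mulr1.
Qed.

Lemma derive_at0 (u : R -> R) l : is_derive (0 : R) 1 u l -> forall e, 0 < e ->
  exists2 d : R, 0 < d & forall h, `|h| < d -> `|u h - u 0 - l * h| <= e * `|h|.
Proof.
move=> [hu <-] e e0.
have /cvgrPdist_lt/(_ _ e0) /nbhs_ballP[d /= d0 hd] := hu.
exists d => // h hd'; have [->|h0] := eqVneq h 0; first by rewrite subrr mulr0 subr0 normr0 mulr0.
have := hd h; rewrite /ball/= sub0r normrN => /(_ hd' h0) /ltW.
rewrite -[h *: 1]/(h * 1) mulr1 addr0 -[_ *: _]/(h^-1 * _).
rewrite -/(derive u 0 1) => hh.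
rewrite (_ : u h - _ - _ = - h * ('D_1 u 0 - h^-1 * (u h - u 0))).
  by rewrite normrM normrN mulrC ler_wpM2r.
by field.
Qed.

(** By [cexpD] only the expansion at 0 matters; there cexp h - 1 - h splits into three pieces
    controlled by the first-order expansions of the real exponential, cosine and sine. *)
Lemma cdiff_cexp z : cdiff cexp z.
Proof.
apply/cdiffP; exists (cexp z) => e e0.
have E0 : 0 < expR (complex.Re z) by exact: expR_gt0.
(* The three pieces are bounded by e', 4e' and e' times |h|, which 8e' covers; e' <= 1 gives |1 + a|
   <= 2. *)
pose e' := Num.min 1 (e / expR (complex.Re z) / 8).
have e'0 : 0 < e' by rewrite lt_min ltr01/= !divr_gt0.
have e'1 : e' <= 1 by rewrite ge_min lexx.
have [d1 d10 h1] := derive_at0 (is_derive_expR 0) e'0.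
have [d2 d20 h2] := derive_at0 (is_derive_cos 0) e'0.
have [d3 d30 h3] := derive_at0 (is_derive_sin 0) e'0.
exists (Num.min (Num.min d1 d2) (Num.min d3 e')).
  by rewrite !lt_min d10 d20 d30 ltr01 /= !divr_gt0.
move=> h; rewrite !lt_min => /andP[/andP[hd1 hd2] /andP[hd3 hd4]].
have hre := Re_le_cmod h; have him := Im_le_cmod h.
have := h1 _ (le_lt_trans hre hd1); have := h2 _ (le_lt_trans him hd2).
have := h3 _ (le_lt_trans him hd3).
rewrite expR0 cos0 sin0 oppr0 mul0r !mul1r !subr0 addr0.
set a := complex.Re h in hre *; set b := complex.Im h in him * => hs hc hx.
have -> : cexp (z + h) - cexp z - cexp z * h = cexp z * (cexp h - 1 - h).
  by rewrite cexpD; ring.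
rewrite cmodM cmod_cexp.
set u := Complex (cos b - 1) (sin b - b).
have um : cmod u <= 2 * e' * cmod h.
  rewrite (le_trans (cmod_le_ReIm _))//=.
  rewrite (_ : 2 * e' * cmod h = e' * cmod h + e' * cmod h); last by ring.
  by apply: lerD; [apply: le_trans hc _|apply: le_trans hs _]; rewrite ler_pM2l.
have vm : cmod (Complex (cos b) (sin b)) = 1 by rewrite cmodE /= cos2Dsin2 sqrtr1.
have -> : cexp h - 1 - h = (expR a - 1 - a)%:C * Complex (cos b) (sin b)
     + (1 + a)%:C * u + (a%:C * Complex 0 b).
  rewrite /cexp -/a -/b /u; apply/eqP; rewrite [h]complexE -/a -/b eq_complex /=.
  by apply/andP; split; apply/eqP; ring.
have hc0 := cmod_ge0 h.
have A1 : cmod ((expR a - 1 - a)%:C * Complex (cos b) (sin b)) <= e' * cmod h.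
  by rewrite cmodM vm mulr1 cmod_real (le_trans hx)// ler_pM2l.
have A2 : cmod ((1 + a)%:C * u) <= 4 * e' * cmod h.
  rewrite cmodM cmod_real (_ : 4 * e' * cmod h = 2 * (2 * e' * cmod h)); last by ring.
  rewrite ler_pM ?cmod_ge0// (le_trans (ler_normD _ _))// normr1; lra.
have A3 : cmod (a%:C * Complex 0 b) <= e' * cmod h.
  rewrite cmodM cmod_real [cmod (Complex _ _)]cmodE /= expr0n add0r sqrtr_sqr.
  by rewrite ler_pM// (le_trans hre)// ltW// lt_min.
have A : cmod ((expR a - 1 - a)%:C * Complex (cos b) (sin b)
     + (1 + a)%:C * u + (a%:C * Complex 0 b)) <= 8 * e' * cmod h.
  rewrite (le_trans (cmodD _ _))// (le_trans (lerD (cmodD _ _) (lexx _)))//.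
  have := mulr_ge0 (ltW e'0) hc0; lra.
rewrite (le_trans (ler_wpM2l (ltW E0) A))// mulrA ler_wpM2r//.
have : e' <= e / expR (complex.Re z) / 8 by rewrite ge_min lexx orbT.
by rewrite ler_pdivlMr// ler_pdivlMr// => ?; lra.
Qed.

Lemma cdiff_ctn_comp f (F : R -> R[i]) t : cdiff f (F t) -> ctn F t -> ctn (fun s => f (F s)) t.
Proof.
move=> hf hF e e0; have [r r0 hr] := cdiff_ctn hf e0.
by have [d d0 hd] := hF _ r0; exists d => // s /hd/hr.
Qed.

End ComplexDerivative.

(** * Goursat's theorem *)

Section Goursat.
Context (R : realType).
Implicit Types (x y l k s t e : R) (G : R[i] -> R[i]).

Lemma nested_intervals (a b : nat -> R) :
  (forall n, a n <= a n.+1) -> (forall n, b n.+1 <= b n) -> (forall n, a n <= b n) ->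
  exists X, forall n, a n <= X <= b n.
Proof.
move=> ha hb hab.
have amono n m : (n <= m)%N -> a n <= a m.
  by move=> /subnK <-; elim: (m - n)%N => // i IH; rewrite addSn (le_trans IH).
have bmono n m : (n <= m)%N -> b m <= b n.
  by move=> /subnK <-; elim: (m - n)%N => // i IH; rewrite addSn (le_trans _ IH).
have anb n m : a n <= b m.
  by rewrite (le_trans (amono _ _ (leq_maxl n m)))// (le_trans (hab _))// bmono// leq_maxr.
exists (sup (range a)) => n; apply/andP; split.
  by apply: ub_le_sup; [exists (b 0%N) => _ [m _ <-]|exists n].
by apply: ge_sup; [exists (a 0%N), 0%N|move=> _ [m _ <-]].
Qed.

(** The counterclockwise integral of G dz along the boundary of the rectangle with lower left corner
    x + iy, width l and height k. Opposite sides are paired under one integral, so that differences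
    of G appear directly. *)
Definition rect_int G x y l k : R[i] :=
  cint x (x + l) (fun t => G (Complex t y) - G (Complex t (y + k))) +
  'i * cint y (y + k) (fun t => G (Complex (x + l) t) - G (Complex x t)).

Definition rect_diff G x y l k := forall s t, x <= s <= x + l -> y <= t <= y + k ->
  cdiff G (Complex s t).

Lemma ctn_horizontal y t : ctn (fun s => Complex s y) t.
Proof.
move=> e e0; exists e => // s; apply: le_lt_trans.
by rewrite (le_trans (cmod_le_ReIm _))//= subrr normr0 addr0.
Qed.

Lemma ctn_vertical x t : ctn (fun s => Complex x s) t.
Proof.
move=> e e0; exists e => // s; apply: le_lt_trans.
by rewrite (le_trans (cmod_le_ReIm _))//= subrr normr0 add0r.
Qed.

Lemma rect_diff_horizontal G x y l k t : rect_diff G x y l k -> y <= t <= y + k ->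
  ctnC x (x + l) (fun s => G (Complex s t)).
Proof. by move=> h ht s hs; apply: cdiff_ctn_comp; [exact: h|exact: ctn_horizontal]. Qed.

Lemma rect_diff_vertical G x y l k s : rect_diff G x y l k -> x <= s <= x + l ->
  ctnC y (y + k) (fun t => G (Complex s t)).
Proof. by move=> h ht t hs; apply: cdiff_ctn_comp; [exact: h|exact: ctn_vertical]. Qed.

Lemma ctnCB a b (F G : R -> R[i]) : ctnC a b F -> ctnC a b G ->
  ctnC a b (fun t => F t - G t).
Proof. by move=> hF hG t ht; apply: ctnD; [exact: hF|apply: ctnN; exact: hG]. Qed.

Lemma rect_int_split_h G x y l l' k : 0 <= l -> 0 <= l' -> 0 <= k ->
  rect_diff G x y (l + l') k ->
  rect_int G x y (l + l') k = rect_int G x y l k + rect_int G (x + l) y l' k.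
Proof.
move=> l0 l'0 k0 h; rewrite /rect_int addrA.
have yy : y <= y <= y + k by lra.
have yk : y <= y + k <= y + k by lra.
have c1 := rect_diff_horizontal h yy; have c2 := rect_diff_horizontal h yk.
have xx : x <= x <= x + (l + l') by lra.
have xl : x <= x + l <= x + (l + l') by lra.
have xll : x <= x + l + l' <= x + (l + l') by lra.
have d1 := rect_diff_vertical h xx; have d2 := rect_diff_vertical h xl.
have d3 := rect_diff_vertical h xll.
rewrite (@cint_cat _ x (x + l) (x + l + l')); [|lra|lra|by rewrite -addrA; exact: ctnCB].
rewrite [in LHS](@eq_cint _ y _ _ (fun t => (G (Complex (x + l) t) - G (Complex x t))
  + (G (Complex (x + l + l') t) - G (Complex (x + l) t)))); last first.
  by move=> t _; ring.
by rewrite (cintD (ctnCB d2 d1) (ctnCB d3 d2)); ring.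
Qed.

Lemma rect_int_split_v G x y l k k' : 0 <= l -> 0 <= k -> 0 <= k' ->
  rect_diff G x y l (k + k') ->
  rect_int G x y l (k + k') = rect_int G x y l k + rect_int G x (y + k) l k'.
Proof.
move=> l0 k0 k'0 h; rewrite /rect_int addrA.
have yy : y <= y <= y + (k + k') by lra.
have yk : y <= y + k <= y + (k + k') by lra.
have ykk : y <= y + k + k' <= y + (k + k') by lra.
have c1 := rect_diff_horizontal h yy; have c2 := rect_diff_horizontal h yk.
have c3 := rect_diff_horizontal h ykk.
have xx : x <= x <= x + l by lra.
have xl : x <= x + l <= x + l by lra.
have d1 := rect_diff_vertical h xx; have d2 := rect_diff_vertical h xl.
rewrite (@cint_cat _ y (y + k) (y + k + k')); [|lra|lra|by rewrite -addrA; exact: ctnCB].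
rewrite [in LHS](@eq_cint _ x _ _ (fun t => (G (Complex t y) - G (Complex t (y + k)))
  + (G (Complex t (y + k)) - G (Complex t (y + k + k'))))); last first.
  by move=> t _; ring.
by rewrite (cintD (ctnCB c1 c2) (ctnCB c2 c3)); ring.
Qed.

Lemma rect_diff_sub G x y l k x' y' l' k' : x <= x' -> x' + l' <= x + l -> y <= y' ->
  y' + k' <= y + k -> rect_diff G x y l k -> rect_diff G x' y' l' k'.
Proof.
by move=> h1 h2 h3 h4 h s t /andP[s1 s2] /andP[t1 t2]; apply: h; lra.
Qed.

(** The integrals over the four quarters add up to the whole, since the inner sides cancel; hence
    the ratio of integral to area exceeds e on at least one of them. *)
Lemma rect_int_quarter G x y l k e : 0 <= l -> 0 <= k -> rect_diff G x y l k ->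
  e * (l * k) < cmod (rect_int G x y l k) ->
  exists p : R * R, [/\ x <= p.1, p.1 + l / 2 <= x + l, y <= p.2, p.2 + k / 2 <= y + k &
    e * (l / 2 * (k / 2)) < cmod (rect_int G p.1 p.2 (l / 2) (k / 2))].
Proof.
move=> l0 k0 h; apply: contraPP => /forallNP hn; apply/negP; rewrite -leNgt.
have hq p : x <= p.1 -> p.1 + l / 2 <= x + l -> y <= p.2 -> p.2 + k / 2 <= y + k ->
    cmod (rect_int G p.1 p.2 (l / 2) (k / 2)) <= e * (l / 2 * (k / 2)).
  by move=> p1 p2 p3 p4; rewrite leNgt; apply/negP => p5; apply: (hn p).
have l20 : 0 <= l / 2 by rewrite divr_ge0.
have k20 : 0 <= k / 2 by rewrite divr_ge0.
have x2 : x + l / 2 <= x + l by lra.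
have x3 : x <= x + l / 2 by lra.
have x4 : x + l / 2 + l / 2 <= x + l by lra.
have y2 : y + k / 2 <= y + k by lra.
have y3 : y <= y + k / 2 by lra.
have y4 : y + k / 2 + k / 2 <= y + k by lra.
have q1 := hq (x, y) (lexx x) x2 (lexx y) y2.
have q2 := hq (x + l / 2, y) x3 x4 (lexx y) y2.
have q3 := hq (x, y + k / 2) (lexx x) x2 y3 y4.
have q4 := hq (x + l / 2, y + k / 2) x3 x4 y3 y4.
have el : l = l / 2 + l / 2 by rewrite -splitr.
have ek : k = k / 2 + k / 2 by rewrite -splitr.
have sp : rect_int G x y l k = rect_int G x y (l / 2) (k / 2)
    + rect_int G x (y + k / 2) (l / 2) (k / 2)
    + (rect_int G (x + l / 2) y (l / 2) (k / 2)
    + rect_int G (x + l / 2) (y + k / 2) (l / 2) (k / 2)).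
  rewrite {1}el {1}ek rect_int_split_h -?el -?ek//.
  rewrite {1}[in rect_int G x y _ k]ek {1}[in rect_int G _ y _ k]ek.
  rewrite !rect_int_split_v -?ek//; apply: rect_diff_sub h => //.
rewrite sp (le_trans (cmodD _ _))// (le_trans (lerD (cmodD _ _) (cmodD _ _)))//.
rewrite (_ : e * (l * k) = e * (l / 2 * (k / 2)) + e * (l / 2 * (k / 2))
  + (e * (l / 2 * (k / 2)) + e * (l / 2 * (k / 2)))); last by field.
exact: (lerD (lerD q1 q3) (lerD q2 q4)).
Qed.

(** Between opposite sides the affine part of G differs by the constants -ikd and ld, whose
    contributions to the boundary integral cancel. What remains is the error e, counted once for
    each side. *)
Lemma rect_int_small G x y l k s t (d : R[i]) e : 0 <= l -> 0 <= k ->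
  rect_diff G x y l k ->
  (forall s' t', x <= s' <= x + l -> y <= t' <= y + k -> 
    cmod (G (Complex s' t') - G (Complex s t) - d * (Complex s' t' - Complex s t)) <= e) ->
  cmod (rect_int G x y l k) <= 2 * e * (l + k).
Proof.
move=> l0 k0 h hG.
have yy : y <= y <= y + k by lra.
have yk : y <= y + k <= y + k by lra.
have c1 := rect_diff_horizontal h yy; have c2 := rect_diff_horizontal h yk.
have xx : x <= x <= x + l by lra.
have xl : x <= x + l <= x + l by lra.
have d1 := rect_diff_vertical h xx; have d2 := rect_diff_vertical h xl.
have cst a b z : ctnC a b (fun _ : R => z : R[i]) by move=> u _; exact: ctn_cst.
have -> : rect_int G x y l k =
  cint x (x + l) (fun u => G (Complex u y) - G (Complex u (y + k)) - (- 'i * k%:C * d)) +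
  'i * cint y (y + k) (fun u => G (Complex (x + l) u) - G (Complex x u) - l%:C * d).
  have b1 := ctnCB c1 c2; have b2 := ctnCB d2 d1.
  rewrite /rect_int (cintB b1)// (cintB b2)// !cint_cst; [|lra|lra].
  have -> : x + l - x = l by ring.
  have -> : y + k - y = k by ring.
  by ring.
rewrite (le_trans (cmodD _ _))// mulrDr.
apply: lerD.
  apply: (le_trans (cmod_cint_le _ _ (m := 2 * e) _)); [lra| | |].
  - by apply: ctnCB => //; exact: ctnCB.
  - move=> u hu; have := hG u _ hu yy; have := hG u _ hu yk => /= hu1 hu2.
    rewrite (_ : _ - _ = (G (Complex u y) - G (Complex s t) - d * (Complex u y - Complex s t))
       - (G (Complex u (y + k)) - G (Complex s t) - d * (Complex u (y + k) - Complex s t))).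
      rewrite (le_trans (cmodB _ _))//; lra.
    rewrite (_ : - 'i * k%:C = Complex u y - Complex u (y + k)); first by ring.
    by apply/eqP; rewrite eq_complex /=; apply/andP; split; apply/eqP; ring.
  - by rewrite addrAC subrr add0r.
rewrite cmodM (_ : cmod 'i = 1) ?mul1r; last first.
  by rewrite cmodE /= expr0n expr1n add0r sqrtr1.
apply: (le_trans (cmod_cint_le _ _ (m := 2 * e) _)); [lra| | |].
- by apply: ctnCB => //; exact: ctnCB.
- move=> u hu; have := hG _ u xl hu; have := hG _ u xx hu => /= hu1 hu2.
  rewrite (_ : _ - _ = (G (Complex (x + l) u) - G (Complex s t) - d * (Complex (x + l) u - Complex s t))
       - (G (Complex x u) - G (Complex s t) - d * (Complex x u - Complex s t))).
    rewrite (le_trans (cmodB _ _))//; lra.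
  rewrite (_ : l%:C = Complex (x + l) u - Complex x u); first by ring.
  by apply/eqP; rewrite eq_complex /=; apply/andP; split; apply/eqP; ring.
- by rewrite addrAC subrr add0r.
Qed.

Lemma goursat_rectangle G x y l k : 0 < l -> 0 < k -> rect_diff G x y l k ->
  rect_int G x y l k = 0.
Proof.
move=> l0 k0 h; apply/eqP; rewrite -cmod_eq0 eq_le cmod_ge0 andbT.
rewrite leNgt; apply/negP => E0.
(* Half the initial ratio of integral to area, so that the strict inequality holds for the first
   rectangle. *)
pose e := cmod (rect_int G x y l k) / 2 / (l * k).
have lk0 : 0 < l * k by rewrite mulr_gt0.
have e0 : 0 < e by rewrite !divr_gt0.
pose L n : R := l / 2 ^+ n; pose K n : R := k / 2 ^+ n.
have L0 n : 0 < L n by rewrite divr_gt0// exprn_gt0.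
have K0 n : 0 < K n by rewrite divr_gt0// exprn_gt0.
have LS n : L n.+1 = L n / 2 by rewrite /L exprSr invfM mulrA.
have KS n : K n.+1 = K n / 2 by rewrite /K exprSr invfM mulrA.
pose bad n (p : R * R) := rect_diff G p.1 p.2 (L n) (K n) /\
  e * (L n * K n) < cmod (rect_int G p.1 p.2 (L n) (K n)).
(* The implication makes a successor exist for every pair, bad or not, as [choice] demands. *)
pose nxt n (p q : R * R) := bad n p -> [/\ p.1 <= q.1, q.1 + L n.+1 <= p.1 + L n,
  p.2 <= q.2, q.2 + K n.+1 <= p.2 + K n & bad n.+1 q].
have hs (np : nat * (R * R)) : exists q, nxt np.1 np.2 q.
  case: np => n p /=; have [[hd hb]|] := pselect (bad n p); last by move=> nb; exists p.
  have [q [q1 q2 q3 q4 q5]] := rect_int_quarter (ltW (L0 n)) (ltW (K0 n)) hd hb.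
  exists q => _; rewrite /bad LS KS; split => //; split => //.
  by apply: rect_diff_sub hd.
have [f hf] := choice hs.
pose P := fix P n := if n is m.+1 then f (m, P m) else (x, y).
have hP n : bad n (P n).
  elim: n => [|n IH]; last by have [] := hf (n, P n) IH.
  rewrite /bad (_ : (P 0%N).1 = x)// (_ : (P 0%N).2 = y)// /L /K expr0 !divr1.
  by split => //; rewrite /e divfK ?gt_eqF//; lra.
have hPS n : [/\ (P n).1 <= (P n.+1).1, (P n.+1).1 + L n.+1 <= (P n).1 + L n,
  (P n).2 <= (P n.+1).2 & (P n.+1).2 + K n.+1 <= (P n).2 + K n].
  by have [] := hf (n, P n) (hP n).
have [X hX] : exists X, forall n, (P n).1 <= X <= (P n).1 + L n.
  by apply: nested_intervals => n; [case: (hPS n)|case: (hPS n)|rewrite lerDl ltW].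
have [Y hY] : exists Y, forall n, (P n).2 <= Y <= (P n).2 + K n.
  by apply: nested_intervals => n; [case: (hPS n)|case: (hPS n)|rewrite lerDl ltW].
have : cdiff G (Complex X Y).
  by apply: h; [have := hX 0%N|have := hY 0%N]; rewrite /= /L /K expr0 !divr1.
move=> /cdiffP[d hd].
(* Both sides shrink by the same factor, so this eta makes 2 eta (L n + K n)^2 equal to e (L n)(K n)
   at every stage, which contradicts badness. *)
pose eta := e * (l * k) / (2 * (l + k) ^+ 2).
have lk20 : 0 < (l + k) ^+ 2 by rewrite exprn_gt0// addr_gt0.
have eta0 : 0 < eta by rewrite divr_gt0// mulr_gt0.
have [r r0 hr] := hd _ eta0.
have [n hn] : exists n, L n + K n < r.
  have /cvgrPdist_lt/(_ _ r0) := @cvg_geometric R (l + k) 2^-1 ltac:(rewrite ger0_norm; lra).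
  case=> n _ hn; exists n; have := hn n (leqnn n).
  rewrite /= sub0r normrN ger0_norm; last by rewrite mulr_ge0 ?exprn_ge0//; lra.
  by rewrite /geometric /= exprVn mulrDl.
have [hdn hbn] := hP n.
have := @rect_int_small G (P n).1 (P n).2 (L n) (K n) X Y d (eta * (L n + K n))
  (ltW (L0 n)) (ltW (K0 n)) hdn.
have hh s' t' : (P n).1 <= s' <= (P n).1 + L n -> (P n).2 <= t' <= (P n).2 + K n ->
    cmod (G (Complex s' t') - G (Complex X Y) - d * (Complex s' t' - Complex X Y)) <=
    eta * (L n + K n).
  move=> hs' ht'.
  have hb : cmod (Complex s' t' - Complex X Y) <= L n + K n.
    rewrite (le_trans (cmod_le_ReIm _))//=; have := hX n; have := hY n => hYn hXn.
    by apply: lerD; rewrite ler_norml; lra.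
  have := hr _ (le_lt_trans hb hn); rewrite [Complex X Y + _]addrC subrK.
  by move=> hh; rewrite (le_trans hh)// ler_pM2l.
move=> /(_ hh); rewrite leNgt => /negP; apply; apply: le_lt_trans hbn.
rewrite (_ : 2 * _ * _ = e * (L n * K n))// /eta /L /K.
by field; rewrite ?expf_neq0 ?gt_eqF//= addr_gt0.
Qed.

End Goursat.

(** * Means over circles *)

Section CircleMean.
Context (R : realType).
Implicit Types (s t a b m : R) (z w : R[i]) (F G : R[i] -> R[i]) (u v : R[i] -> R).
Local Notation pi2 := (2 * pi : R).

Definition circ s t : R[i] := Complex (s * cos t) (s * sin t).

Definition ccont F w := forall e : R, 0 < e -> exists2 r : R, 0 < r &
  forall w', cmod (w' - w) < r -> cmod (F w' - F w) < e.

Definition ccirc s F := ctnC 0 pi2 (fun t => F (circ s t)).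
Definition rcirc s u := ctnR 0 pi2 (fun t => u (circ s t)).

Definition cmean s F : R[i] := (pi2^-1)%:C * cint 0 pi2 (fun t => F (circ s t)).
Definition rmean s u : R := pi2^-1 * Ri 0 pi2 (fun t => u (circ s t)).

Lemma pi2_gt0 : 0 < pi2.
Proof. by rewrite mulr_gt0// pi_gt0. Qed.

Lemma cmod_circ s t : 0 <= s -> cmod (circ s t) = s.
Proof.
move=> s0; rewrite cmodE /= !exprMn -mulrDr cos2Dsin2 mulr1.
by rewrite sqrtr_sqr ger0_norm.
Qed.

Lemma cmod_circB s s' t : cmod (circ s t - circ s' t) = `|s - s'|.
Proof.
rewrite cmodE /= -!mulrBl !exprMn -mulrDr cos2Dsin2 mulr1.
by rewrite sqrtr_sqr.
Qed.

Lemma ctn_circ s t : ctn (circ s) t.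
Proof.
apply/ctn_ReIm; split => /=; apply: cvgM; try exact: cvg_cst.
  exact: continuous_cos.
exact: continuous_sin.
Qed.

Lemma cdiff_ccont F w : cdiff F w -> ccont F w.
Proof. exact: cdiff_ctn. Qed.

Lemma ccont_circ s F : 0 <= s -> (forall w, cmod w = s -> ccont F w) -> ccirc s F.
Proof.
move=> s0 h t _ e e0; have [r r0 hr] := h _ (cmod_circ t s0) _ e0.
by have [d d0 hd] := @ctn_circ s t _ r0; exists d => // s' /hd/hr.
Qed.

Lemma cdiff_circ s F : 0 <= s -> (forall w, cmod w = s -> cdiff F w) -> ccirc s F.
Proof. by move=> s0 h; apply: ccont_circ => // w /h; exact: cdiff_ccont. Qed.

Lemma ctnM (F G : R -> R[i]) t : ctn F t -> ctn G t -> ctn (fun s => F s * G s) t.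
Proof.
move=> hF hG e e0.
pose M := cmod (F t) + cmod (G t) + 2.
have cF := cmod_ge0 (F t); have cG := cmod_ge0 (G t).
have M0 : 0 < M by rewrite /M; lra.
have e1 : 0 < Num.min 1 (e / (2 * M)) by rewrite lt_min ltr01 divr_gt0// mulr_gt0.
have [d1 d10 hd1] := hF _ e1; have [d2 d20 hd2] := hG _ e1.
exists (Num.min d1 d2); first by rewrite lt_min d10.
move=> s; rewrite lt_min => /andP[/hd1 + /hd2]; rewrite !lt_min => /andP[f1 f2] /andP[g1 g2].
rewrite (_ : _ - _ = F s * (G s - G t) + G t * (F s - F t)); last by ring.
rewrite (le_lt_trans (cmodD _ _))// !cmodM.
have cs : cmod (F s) <= M.
  by have := cmodD (F s - F t) (F t); rewrite subrK /M; lra.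
rewrite (_ : e = M * (e / (2 * M)) + M * (e / (2 * M))); last by field; rewrite gt_eqF.
have gM : cmod (G t) <= M by rewrite /M; lra.
apply: ltr_leD.
  apply: (@le_lt_trans _ _ (M * cmod (G s - G t))); first by rewrite ler_wpM2r// cmod_ge0.
  by rewrite ltr_pM2l.
by apply: ler_pM => //; [exact: cmod_ge0|exact: ltW].
Qed.

Lemma ccircM s F G : ccirc s F -> ccirc s G -> ccirc s (fun w => F w * G w).
Proof. by move=> hF hG t ht; apply: (ctnM (hF t ht) (hG t ht)). Qed.

Lemma ccircD s F G : ccirc s F -> ccirc s G -> ccirc s (fun w => F w + G w).
Proof. by move=> hF hG t ht; apply: (ctnD (hF t ht) (hG t ht)). Qed.

Lemma ccircN s F : ccirc s F -> ccirc s (fun w => - F w).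
Proof. by move=> hF t ht; apply: (ctnN (hF t ht)). Qed.

Lemma ccirc_cst s z : ccirc s (fun=> z).
Proof. by move=> t _; exact: ctn_cst. Qed.

Lemma ccirc_id s : ccirc s id.
Proof. by move=> t _; exact: ctn_circ. Qed.

Lemma rcirc_cmod s F : ccirc s F -> rcirc s (fun w => cmod (F w)).
Proof. by move=> hF t ht; apply: (ctn_cmod (hF t ht)). Qed.

Lemma rcircM s u v : rcirc s u -> rcirc s v -> rcirc s (fun w => u w * v w).
Proof. by move=> hu hv t ht; apply: cvgM; [exact: hu|exact: hv]. Qed.

Lemma rcircD s u v : rcirc s u -> rcirc s v -> rcirc s (fun w => u w + v w).
Proof. by move=> hu hv t ht; apply: cvgD; [exact: hu|exact: hv]. Qed.

Lemma rcirc_cst s m : rcirc s (fun=> m).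
Proof. by move=> t _; exact: cvg_cst. Qed.

Lemma ccirc_real s u : rcirc s u -> ccirc s (fun w => (u w)%:C).
Proof. by move=> hu t ht; apply/ctn_ReIm; split => /=; [exact: hu|exact: cvg_cst]. Qed.

Lemma eq_cmean s F G : 0 <= s -> (forall w, cmod w = s -> F w = G w) -> cmean s F = cmean s G.
Proof. by move=> s0 h; congr (_ * _); apply: eq_cint => t _; apply: h; exact: cmod_circ. Qed.

Lemma eq_rmean s u v : 0 <= s -> (forall w, cmod w = s -> u w = v w) -> rmean s u = rmean s v.
Proof. by move=> s0 h; congr (_ * _); apply: eq_Ri => t _; apply: h; exact: cmod_circ. Qed.

Lemma cmeanD s F G : ccirc s F -> ccirc s G ->
  cmean s (fun w => F w + G w) = cmean s F + cmean s G.
Proof. by move=> hF hG; rewrite /cmean cintD// mulrDr. Qed.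

Lemma cmeanZ s z F : ccirc s F -> cmean s (fun w => z * F w) = z * cmean s F.
Proof. by move=> hF; rewrite /cmean cintZ// mulrCA. Qed.

Lemma cmeanB s F G : ccirc s F -> ccirc s G ->
  cmean s (fun w => F w - G w) = cmean s F - cmean s G.
Proof. by move=> hF hG; rewrite /cmean cintB// mulrBr. Qed.

Lemma cmean_cst s z : cmean s (fun=> z) = z.
Proof.
rewrite /cmean cint_cst ?(ltW pi2_gt0)// subr0 mulrA -rmorphM mulVf ?mul1r//.
by rewrite gt_eqF// pi2_gt0.
Qed.

Lemma ccirc_sum (I : Type) (r : seq I) s (F : I -> R[i] -> R[i]) :
  (forall i, ccirc s (F i)) -> ccirc s (fun w => \sum_(i <- r) F i w).
Proof.
move=> hF; elim: r => [|i r IH] t ht.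
  under [X in ctn X]funext do rewrite big_nil.
  exact: ctn_cst.
under [X in ctn X]funext do rewrite big_cons.
by apply: ctnD; [exact: hF|exact: IH].
Qed.

Lemma cmean_sum (I : Type) (r : seq I) s (F : I -> R[i] -> R[i]) :
  (forall i, ccirc s (F i)) ->
  cmean s (fun w => \sum_(i <- r) F i w) = \sum_(i <- r) cmean s (F i).
Proof.
move=> hF; elim: r => [|i r IH].
  by under [X in cmean s X]funext do rewrite big_nil; rewrite big_nil cmean_cst.
under [X in cmean s X]funext do rewrite big_cons.
by rewrite big_cons cmeanD ?IH//; exact: ccirc_sum.
Qed.

Lemma cmean_real s u : cmean s (fun w => (u w)%:C) = (rmean s u)%:C.
Proof.
rewrite /cmean /rmean rmorphM /=; congr (_ * _); rewrite /cint /=; congr Complex.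
by rewrite Ri_cst ?mul0r ?(ltW pi2_gt0).
Qed.

Lemma rmeanD s u v : rcirc s u -> rcirc s v ->
  rmean s (fun w => u w + v w) = rmean s u + rmean s v.
Proof. by move=> hu hv; rewrite /rmean RiD// mulrDr. Qed.

Lemma rmeanZ s m u : rcirc s u -> rmean s (fun w => m * u w) = m * rmean s u.
Proof. by move=> hu; rewrite /rmean RiZ// mulrCA. Qed.

Lemma rmean_cst s m : rmean s (fun=> m) = m.
Proof. by rewrite /rmean Ri_cst ?(ltW pi2_gt0)// subr0 mulrCA mulVf ?mulr1// gt_eqF// pi2_gt0. Qed.

Lemma le_rmean s u v : 0 <= s -> rcirc s u -> rcirc s v ->
  (forall w, cmod w = s -> u w <= v w) -> rmean s u <= rmean s v.
Proof.
move=> s0 hu hv h; rewrite /rmean ler_pM2l ?invr_gt0 ?pi2_gt0//.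
by apply: le_Ri => // t _; apply: h; exact: cmod_circ.
Qed.

Lemma rmean_ge0 s u : (forall w, 0 <= u w) -> 0 <= rmean s u.
Proof. by move=> h; rewrite mulr_ge0 ?invr_ge0 ?(ltW pi2_gt0)// Ri_ge0. Qed.

Lemma cmod_cmean s F : ccirc s F -> cmod (cmean s F) <= rmean s (fun w => cmod (F w)).
Proof.
move=> hF; rewrite cmodM cmod_real ger0_norm ?invr_ge0 ?(ltW pi2_gt0)//.
by rewrite ler_pM2l ?invr_gt0 ?pi2_gt0// cmod_cint.
Qed.

Lemma cmod_cmean_le s F m : 0 <= s -> ccirc s F -> (forall w, cmod w = s -> cmod (F w) <= m) ->
  cmod (cmean s F) <= m.
Proof.
move=> s0 hF h; rewrite (le_trans (cmod_cmean hF))// -[leRHS](rmean_cst s).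
by apply: le_rmean => //; [exact: rcirc_cmod|exact: rcirc_cst].
Qed.

Lemma cmean0 F : cmean 0 F = F 0.
Proof.
rewrite -[RHS](cmean_cst 0); apply: eq_cmean => // w /eqP.
by rewrite cmod_eq0 => /eqP ->.
Qed.

Lemma cexp_circ x t : cexp (Complex x t) = circ (expR x) t.
Proof. by apply/eqP; rewrite eq_complex /= !mul0r subr0 addr0 !eqxx. Qed.

(* Goursat's theorem on a rectangle of the logarithmic plane. *)
Lemma cmean_annulus_lt F a b s s' : 0 <= a -> a < s -> s < s' -> s' < b ->
  (forall w, a < cmod w < b -> cdiff F w) -> cmean s F = cmean s' F.
Proof.
move=> a0 as_ ss sb hF; have s0 : 0 < s by lra.
have s'0 : 0 < s' by lra.
have l0 : 0 < ln s' - ln s by rewrite subr_gt0 ltr_ln ?posrE.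
have h : rect_diff (fun z => F (cexp z)) (ln s) 0 (ln s' - ln s) pi2.
  move=> x t hx ht; apply: cdiff_comp; first exact: cdiff_cexp.
  apply: hF; rewrite cmod_cexp /=; move: hx; rewrite addrC subrK => /andP[x1 x2].
  rewrite (@lt_le_trans _ _ s)//=; last by rewrite -[s]lnK ?posrE// ler_expR.
  by rewrite (@le_lt_trans _ _ s')//=; rewrite -[s']lnK ?posrE// ler_expR.
have := goursat_rectangle l0 pi2_gt0 h.
rewrite /rect_int add0r addrC [ln s + _]addrC subrK.
(* The lower and upper sides of the rectangle have the same image under [cexp], by 2
   pi-periodicity. *)
rewrite [X in _ + X](_ : _ = 0) ?addr0; last first.
  rewrite (@eq_cint _ _ _ _ (fun=> 0)) ?cint_cst ?mulr0//; first by rewrite ler_ln ?posrE ?ltW.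
  by move=> t _; rewrite !cexp_circ /circ -[2 * pi]add0r mulr_natl cosD2pi sinD2pi subrr.
move=> /eqP; rewrite mulf_eq0 (_ : ('i == 0) = false) /=; last first.
  by rewrite eq_complex /= oner_eq0 andbF.
have c1 : ccirc s F by apply: (cdiff_circ (ltW s0)) => w we; apply: hF; lra.
have c2 : ccirc s' F by apply: (cdiff_circ (ltW s'0)) => w we; apply: hF; lra.
rewrite (@eq_cint _ _ _ _ (fun t => F (circ s' t) - F (circ s t))); last first.
  by move=> t _; rewrite !cexp_circ !lnK ?posrE.
by rewrite cintB// subr_eq0 => /eqP e; rewrite /cmean e.
Qed.

Lemma cmean_annulus F a b s s' : 0 <= a -> a < s < b -> a < s' < b ->
  (forall w, a < cmod w < b -> cdiff F w) -> cmean s F = cmean s' F.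
Proof.
move=> a0 /andP[as_ sb] /andP[as' sb'] hF.
have [ss|ss|->//] := ltgtP s s'.
  exact: (cmean_annulus_lt a0 as_ ss sb' hF).
by rewrite (cmean_annulus_lt a0 as' ss sb hF).
Qed.

Lemma eq_of_cmod_le z w : (forall e : R, 0 < e -> cmod (z - w) <= e) -> z = w.
Proof.
move=> h; apply/eqP; rewrite -subr_eq0 -cmod_eq0 eq_le cmod_ge0 andbT.
by apply/ler_addgt0Pr => e e0; rewrite add0r h.
Qed.

(** The mean does not depend on the radius, and continuity at 0 identifies its limit as the circle
    shrinks. *)
Lemma mean_value F b s : 0 <= s < b -> (forall w, cmod w < b -> cdiff F w) -> cmean s F = F 0.
Proof.
move=> /andP[]; rewrite le_eqVlt => /predU1P[<- _ _|s0 sb hF]; first exact: cmean0.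
apply: eq_of_cmod_le => e e0.
have [r r0 hr] := cdiff_ccont (hF 0 (ltac:(rewrite cmod0; lra))) e0.
pose s' := Num.min (r / 2) s; have s'0 : 0 < s' by rewrite lt_min s0 divr_gt0.
have s'r : s' < r by rewrite /s' gt_min; apply/orP; left; lra.
have s's : s' <= s by rewrite /s' ge_min lexx orbT.
have c' : ccirc s' F by apply: cdiff_circ => [|w we]; [exact: ltW|apply: hF; lra].
rewrite (@cmean_annulus F 0 b s s')//; [|lra|lra|by move=> w /andP[_]; exact: hF].
rewrite -[F 0](cmean_cst s') -cmeanB//; last exact: ccirc_cst.
apply: cmod_cmean_le; [exact: ltW| |].
  by apply: ccircD => //; apply: ccirc_cst.
by move=> w we; apply/ltW/hr; rewrite subr0 we.
Qed.

(** Compactness of the parameter interval makes the pointwise continuity of F along |w| = s uniform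
    in the angle. *)
Lemma cmean_cont F s : 0 < s -> (forall w, cmod w = s -> ccont F w) ->
  forall e : R, 0 < e -> exists2 d : R, 0 < d &
    forall s', `|s' - s| < d -> ccirc s' F -> cmod (cmean s' F - cmean s F) <= e.
Proof.
move=> s0 hF e e0.
have K := iffLR (compact_near_coveringP `[0, pi2]%classic) (@segment_compact _ 0 pi2).
have /nbhs_ballP[d /= d0 hd] : \forall s' \near nbhs s, `[0, pi2]%classic `<=`
    (fun t => cmod (F (circ s' t) - F (circ s t)) < e).
  apply: K => t _.
  have [r r0 hr] := hF _ (cmod_circ t (ltW s0)) (e / 2) ltac:(lra).
  have [d d0 hd] := @ctn_circ s t (r / 2) ltac:(lra).
  exists (ball t d, ball s (r / 2)).
    by split; apply/nbhs_ballP; [exists d|exists (r / 2) => //=; lra].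
  move=> [t' s'] [/= tt' ss'].
  have /hd tt : `|t' - t| < d by rewrite distrC; exact: tt'.
  have ss : `|s' - s| < r / 2 by rewrite distrC; exact: ss'.
  have h1 : cmod (circ s t' - circ s t) < r by lra.
  have h2 : cmod (circ s' t' - circ s t) < r.
    have := cmodBD (circ s' t') (circ s t') (circ s t); rewrite cmod_circB; lra.
  have := cmodBD (F (circ s' t')) (F (circ s t)) (F (circ s t')).
  by have := hr _ h1; have := hr _ h2; rewrite [cmod (F (circ s t) - _)]cmodC; lra.
exists d => // s' ss' c'.
have c : ccirc s F by apply: ccont_circ => //; exact: ltW.
have p0 := ltW pi2_gt0.
have -> : cmean s' F - cmean s F =
    (pi2^-1)%:C * cint 0 pi2 (fun t => F (circ s' t) - F (circ s t)).
  by rewrite (cintB c' c) mulrBr.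
rewrite cmodM cmod_real ger0_norm ?invr_ge0//.
rewrite ler_pdivrMl ?pi2_gt0//.
apply: (le_trans (cmod_cint_le p0 _ (m := e) _)); last by rewrite subr0 mulrC.
  by move=> t ht; apply: ctnD; [exact: c'|apply: ctnN; exact: c].
move=> t ht; apply: ltW; apply: hd; last by rewrite /= in_itv.
by rewrite /ball/= distrC.
Qed.

(** One exceptional point is allowed, provided F is continuous there: the mean is constant on either
    side of |z| and continuous at |z|. Applied to [dquot], this does the work of a
    removable-singularity theorem. *)
Lemma cmean_annulus_pt F z a b s : 0 <= a -> a < cmod z < b -> a < s < b ->
  ccont F z -> (forall w, a < cmod w < b -> w != z -> cdiff F w) ->
  cmean s F = cmean (cmod z) F.
Proof.
move=> a0 /andP[az zb] /andP[as_ sb] Fz hF.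
have cF w : a < cmod w < b -> ccont F w.
  by move=> hw; have [->//|wz] := eqVneq w z; apply: cdiff_ccont; exact: hF.
have cc s' : a < s' < b -> ccirc s' F.
  by move=> hs'; apply: ccont_circ => [|w we]; [lra|apply: cF; rewrite we].
have z0 : 0 < cmod z by lra.
have hz w : cmod w = cmod z -> ccont F w by move=> e; apply: cF; rewrite e az.
have [sz|sz|->//] := ltgtP s (cmod z).
- apply: eq_of_cmod_le => e e0; have [d d0 hd] := cmean_cont z0 hz e0.
  pose s' := Num.max ((s + cmod z) / 2) (cmod z - d / 2).
  have s's : s < s' by rewrite lt_max; apply/orP; left; lra.
  have s'z : s' < cmod z by rewrite gt_max; apply/andP; split; lra.
  have s'd : cmod z - d / 2 <= s' by rewrite le_max lexx orbT.
  rewrite (@cmean_annulus F a (cmod z) s s')//; [|lra|lra|].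
    by apply: hd; [rewrite ltr_norml; lra|apply: cc; lra].
  move=> w /andP[aw wz]; apply: hF; first lra.
  by apply: contraTneq wz => ->; rewrite ltxx.
- apply: eq_of_cmod_le => e e0; have [d d0 hd] := cmean_cont z0 hz e0.
  pose s' := Num.min ((s + cmod z) / 2) (cmod z + d / 2).
  have s's : s' < s by rewrite gt_min; apply/orP; left; lra.
  have s'z : cmod z < s' by rewrite lt_min; apply/andP; split; lra.
  have s'd : s' <= cmod z + d / 2 by rewrite ge_min lexx orbT.
  rewrite (@cmean_annulus F (cmod z) b s s')//; [|lra|lra|lra|].
    by apply: hd; [rewrite ltr_norml; lra|apply: cc; lra].
  move=> w /andP[aw wz]; apply: hF; first lra.
  by apply: contraTneq aw => ->; rewrite ltxx.
Qed.

End CircleMean.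

(** * Cauchy and Poisson formulas *)

Section CauchyFormula.
Context (R : realType).
Implicit Types (s t a b m : R) (z w : R[i]) (F G : R[i] -> R[i]) (u v : R[i] -> R).

Lemma cmod_neq z w : cmod z != cmod w -> z != w.
Proof. by apply: contraNneq => ->. Qed.

(** Since dw = iw dt on a circle, the mean of F times this kernel is the Cauchy integral of F at z,
    without the factor 2 pi i. *)
Definition ckernel z w : R[i] := w / (w - z).

Lemma cdiff_ckernel z w : w != z -> cdiff (ckernel z) w.
Proof.
move=> wz; apply: (cdiffM (@cdiff_id R w)); apply: cdiffV; first by rewrite subr_eq0.
by apply: cdiffB; [exact: cdiff_id|exact: cdiff_cst].
Qed.

Lemma ccirc_ckernel z s : 0 <= s -> cmod z != s -> ccirc s (ckernel z).
Proof.
move=> s0 zs; apply: cdiff_circ => // w we; apply: cdiff_ckernel.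
by apply: cmod_neq; rewrite we eq_sym.
Qed.

Lemma cmean_ckernel_out z s : 0 <= s < cmod z -> cmean s (ckernel z) = 0.
Proof.
move=> sz; rewrite (@mean_value _ _ (cmod z))//; first by rewrite /ckernel mul0r.
by move=> w wz; apply: cdiff_ckernel; apply: cmod_neq; rewrite lt_eqF.
Qed.

Lemma cmean_ckernel_in z s : cmod z < s -> cmean s (ckernel z) = 1.
Proof.
move=> zs; apply: eq_of_cmod_le => e e0.
have z0 := cmod_ge0 z.
(* On |w| = s' the kernel differs from 1 by z/(w - z), and this radius makes |z|/(s' - |z|) at most
   e. *)
pose s' := s + cmod z + cmod z / e.
have ze : 0 <= cmod z / e by rewrite divr_ge0// ltW.
have s'0 : cmod z < s' by rewrite /s'; lra.
have s'0' : 0 <= s' by lra.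
have c1 : ccirc s' (ckernel z) by apply: ccirc_ckernel; rewrite ?lt_eqF//; lra.
rewrite (@cmean_annulus _ _ (cmod z) (s + s' + 1) s s')//; [|lra|lra|]; last first.
  move=> w /andP[wz _]; apply: cdiff_ckernel.
  by apply: cmod_neq; rewrite gt_eqF.
rewrite -(cmean_cst s' 1) -cmeanB//; last exact: ccirc_cst.
apply: cmod_cmean_le => //; first by apply: ccircD => //; apply: ccircN; exact: ccirc_cst.
move=> w we; have wz : w - z != 0.
  by rewrite subr_eq0; apply: cmod_neq; rewrite we gt_eqF.
rewrite (_ : ckernel z w - 1 = z / (w - z)); last by rewrite /ckernel; field.
rewrite cmodM cmodV ler_pdivrMr ?cmod_gt0//.
have := ler_cmodB w z; rewrite we => h; rewrite (le_trans _ (ler_wpM2l (ltW e0) h))//.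
rewrite (_ : e * (s' - cmod z) = e * s + cmod z); last by rewrite /s'; field; rewrite gt_eqF.
by rewrite lerDr mulr_ge0//; lra.
Qed.

(** The value at w = z is the limit of the quotient when d is the derivative of F at z; it contains
    the factor w of [ckernel]. *)
Definition dquot F z d w : R[i] := if w == z then d * z else (F w - F z) * ckernel z w.

Lemma cdiff_dquot F z d w : w != z -> cdiff F w -> cdiff (dquot F z d) w.
Proof.
move=> wz hF; have wz0 : 0 < cmod (w - z) by rewrite cmod_gt0 subr_eq0.
apply: (@cdiff_near _ (fun w => (F w - F z) * ckernel z w) _ _ _ wz0).
  move=> w' hw'; rewrite /dquot; case: eqP => // e.
  by move: hw'; rewrite e cmodC ltxx.
apply: cdiffM; last exact: cdiff_ckernel.
by apply: cdiffB; [exact: hF|exact: cdiff_cst].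
Qed.

Lemma ccont_dquot F z : cdiff F z -> exists d, ccont (dquot F z d) z.
Proof.
move=> /cdiffP[d hd]; exists d => e e0; pose e' := e / (2 * (cmod z + 1)).
have cz := cmod_ge0 z; have cd := cmod_ge0 d.
have e'0 : 0 < e' by rewrite divr_gt0//; lra.
have [r r0 hr] := hd _ e'0.
pose e2 := e / (2 * (cmod d + 1)).
have e20 : 0 < e2 by rewrite divr_gt0//; lra.
exists (Num.min (Num.min r 1) e2); first by rewrite !lt_min r0 ltr01.
move=> w; rewrite !lt_min => /andP[/andP[wr w1] we].
rewrite /dquot eqxx; case: eqP => [_|/eqP wz]; first by rewrite subrr cmod0.
have := hr _ wr; rewrite [z + _]addrC subrK => hw.
have wz0 : w - z != 0 by rewrite subr_eq0.
have wz1 : 0 < cmod (w - z) by rewrite cmod_gt0.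
rewrite (_ : _ - _ = (F w - F z - d * (w - z)) / (w - z) * w + d * (w - z)); last first.
  by rewrite /ckernel; field.
have w2 : cmod w <= cmod z + 1 by have := cmodD (w - z) z; rewrite subrK; lra.
have h1 : cmod ((F w - F z - d * (w - z)) / (w - z) * w) <= e / 2.
  rewrite !cmodM cmodV (_ : e / 2 = e' * (cmod z + 1)).
    by apply: ler_pM; rewrite ?cmod_ge0 ?divr_ge0 ?cmod_ge0 ?ler_pdivrMr.
  by rewrite /e'; field; lra.
have h2 : cmod (d * (w - z)) < e / 2.
  rewrite cmodM (@le_lt_trans _ _ ((cmod d + 1) * cmod (w - z)))//.
    by rewrite ler_wpM2r ?cmod_ge0// lerDl.
  rewrite mulrC -ltr_pdivlMr; last by lra.
  by rewrite (_ : e / 2 / (cmod d + 1) = e2)// /e2; field; lra.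
rewrite (le_lt_trans (cmodD _ _))//; lra.
Qed.

Lemma cmean_dquot F z d s : 0 <= s -> cmod z != s -> (forall w, cmod w = s -> cdiff F w) ->
  cmean s (fun w => F w * ckernel z w) = cmean s (dquot F z d) + F z * cmean s (ckernel z).
Proof.
move=> s0 zs hF.
have wz w : cmod w = s -> w != z by move=> we; apply: cmod_neq; rewrite we eq_sym.
have c1 : ccirc s (dquot F z d).
  by apply: (cdiff_circ s0) => w we; apply: cdiff_dquot; [exact: wz|exact: hF].
have c2 : ccirc s (ckernel z) by exact: ccirc_ckernel.
have c3 := ccircM (ccirc_cst s (F z)) c2.
rewrite -(cmeanZ _ c2) -(cmeanD c1 c3); apply: (eq_cmean s0) => w we.
by rewrite /dquot (negbTE (wz _ we)); ring.
Qed.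

(** Write F times the kernel as [dquot] plus F(z) times the kernel. The mean of [dquot] is the same
    on both circles, while that of the kernel jumps from 0 to 1 as the radius crosses |z|. *)
Lemma cauchy_jump F z a b s s' : 0 <= a -> a < s < cmod z -> cmod z < s' < b ->
  (forall w, a < cmod w < b -> cdiff F w) ->
  cmean s' (fun w => F w * ckernel z w) - cmean s (fun w => F w * ckernel z w) = F z.
Proof.
move=> a0 /andP[as_ sz] /andP[zs' s'b] hF.
have zb : a < cmod z < b by rewrite (lt_trans as_ sz) (lt_trans zs' s'b).
have sb : a < s < b by rewrite as_ (lt_trans sz)// (lt_trans zs').
have s'b' : a < s' < b by rewrite s'b andbT (lt_trans as_)// (lt_trans sz).
have [d hd] := ccont_dquot (hF _ zb).
have hq w : a < cmod w < b -> w != z -> cdiff (dquot F z d) w.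
  by move=> /hF hw wz; apply: cdiff_dquot.
have E : cmean s (dquot F z d) = cmean s' (dquot F z d).
  rewrite (cmean_annulus_pt a0 zb sb hd hq).
  by rewrite (cmean_annulus_pt a0 zb s'b' hd hq).
have s0 : 0 <= s by rewrite ltW// (le_lt_trans a0).
have s'0 : 0 <= s' by rewrite ltW// (le_lt_trans (cmod_ge0 z)).
rewrite (@cmean_dquot F z d s') ?lt_eqF//; last by move=> w we; apply: hF; rewrite we.
rewrite (@cmean_dquot F z d s) ?gt_eqF//; last by move=> w we; apply: hF; rewrite we.
rewrite (cmean_ckernel_in zs') cmean_ckernel_out ?s0// E; ring.
Qed.

(** On the circle of radius |z|/2 the product of F and the kernel has mean 0, because the kernel
    vanishes at the origin; the jump is then the whole value. At z = 0 no inner circle exists, and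
    the kernel is 1. *)
Lemma cauchy_formula F z b s : cmod z < s < b ->
  (forall w, cmod w < b -> cdiff F w) -> cmean s (fun w => F w * ckernel z w) = F z.
Proof.
move=> /andP[zs sb] hF; have z0 := cmod_ge0 z.
have [->|zn0] := eqVneq z 0.
  rewrite (@eq_cmean _ _ _ F); first by apply: (mean_value (b := b)) => //; lra.
    by lra.
  move=> w we; rewrite /ckernel subr0 divff ?mulr1//.
  by rewrite -cmod_gt0 we; lra.
have zp : 0 < cmod z by rewrite cmod_gt0.
have h0 : cmean (cmod z / 2) (fun w => F w * ckernel z w) = 0.
  rewrite (@mean_value _ _ (cmod z)); [by rewrite /ckernel mul0r mulr0|lra|].
  move=> w wz; apply: cdiffM; first by apply: hF; lra.
  by apply: cdiff_ckernel; apply: cmod_neq; rewrite lt_eqF.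
have := @cauchy_jump F z 0 b (cmod z / 2) s (lexx _); rewrite h0 subr0; apply; try lra.
by move=> w /andP[_]; exact: hF.
Qed.

Definition poisson s z w : R := (s ^+ 2 - cmod z ^+ 2) / cmod (w - z) ^+ 2.

Lemma poisson_ge0 s z w : cmod z <= s -> 0 <= poisson s z w.
Proof.
move=> zs; rewrite divr_ge0 ?sqr_ge0// subr_ge0 ler_pXn2r// nnegrE ?cmod_ge0//.
by rewrite (le_trans (cmod_ge0 z)).
Qed.

Lemma rcirc_inv s u : rcirc s u -> (forall w, cmod w = s -> u w != 0) -> 0 <= s ->
  rcirc s (fun w => (u w)^-1).
Proof.
move=> hu h0 s0 t ht; apply: cvgV; last exact: hu.
by apply: h0; exact: cmod_circ.
Qed.

Lemma rcirc_poisson s z : 0 <= s -> cmod z != s -> rcirc s (poisson s z).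
Proof.
move=> s0 zs; apply: rcircM; first exact: rcirc_cst.
have c : rcirc s (fun w => cmod (w - z)).
  by apply: rcirc_cmod; apply: ccircD; [exact: ccirc_id|exact: ccirc_cst].
apply: rcirc_inv => //; first by apply: (rcircM c c).
move=> w we; rewrite expf_neq0// cmod_eq0 subr_eq0; apply: cmod_neq.
by rewrite we eq_sym.
Qed.

(* The Cauchy formula for the product of F with the factor
   (s^2 - |z|^2)/(s^2 - z^* w), which turns the Cauchy kernel into the Poisson kernel. *)
Lemma poisson_formula F z b s : cmod z < s < b ->
  (forall w, cmod w < b -> cdiff F w) ->
  F z = cmean s (fun w => F w * (poisson s z w)%:C).
Proof.
move=> /andP[zs sb] hF; have z0 := cmod_ge0 z.
have s0 : 0 < s by lra.
have sz0 : 0 < s + cmod z by lra.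
pose k w := (s ^+ 2 - cmod z ^+ 2)%:C / ((s ^+ 2)%:C - (z^*)%C * w).
(* The extra factor is holomorphic for |w| < s^2/|z|; the radius 2s^2/(s + |z|) lies strictly
   between s and that bound, and stays meaningful at z = 0. *)
pose b' := Num.min b (2 * s ^+ 2 / (s + cmod z)).
have sb' : s < b'.
  by rewrite lt_min sb /= ltr_pdivlMr//; nra.
have hk w : cmod w < b' -> (s ^+ 2)%:C - (z^*)%C * w != 0.
  rewrite lt_min => /andP[_]; rewrite ltr_pdivlMr// => hw.
  rewrite subr_eq0; apply: cmod_neq; rewrite cmod_real cmodM cmodJ ger0_norm ?sqr_ge0//.
  rewrite gt_eqF//; have := cmod_ge0 w.
  have [wc|wc] := leP (cmod w) s; first by nra.
  by nra.
have kz : k z = 1.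
  rewrite /k [_ * z]mulrC mulcJ -rmorphB divff//.
  by rewrite eq_complex /= negb_and gt_eqF//; nra.
have -> : F z = F z * k z by rewrite kz mulr1.
have zs' : cmod z < s < b' by rewrite zs sb'.
rewrite -(@cauchy_formula (fun w => F w * k w) z b' s)//.
  apply: eq_cmean => [|w we]; first exact: ltW.
  rewrite /k /ckernel /poisson -we.
  have wz : w != z by apply: cmod_neq; rewrite we gt_eqF.
  have wz' : w - z != 0 by rewrite subr_eq0.
  have wn0 : w != 0 by rewrite -cmod_gt0 we.
  have divC x y : (x / y)%:C = x%:C / y%:C :> R[i] by rewrite rmorphM fmorphV.
  rewrite divC -[(cmod (w - z) ^+ 2)%:C]mulcJ.
  rewrite -[(cmod w ^+ 2)%:C]mulcJ rmorphB /=.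
  have wzj : (w^*)%C - (z^*)%C != 0 by rewrite -rmorphB conjc_eq0.
  rewrite (_ : w * (w^*)%C - _ = w * ((w^*)%C - (z^*)%C)); last by ring.
  by field; rewrite wn0 wz' wzj.
move=> w hw; have wb : cmod w < b by move: hw; rewrite lt_min => /andP[].
apply: cdiffM; first exact: hF.
apply: cdiffM; first exact: cdiff_cst.
apply: cdiffV; first exact: hk.
apply: cdiffB; first exact: cdiff_cst.
by apply: cdiffM; [exact: cdiff_cst|exact: cdiff_id].
Qed.

Lemma rmean_poisson z s : cmod z < s -> rmean s (poisson s z) = 1.
Proof.
move=> zs; apply: complexI; rewrite -cmean_real rmorph1.
have := @poisson_formula (fun=> 1) z (s + 1) s; rewrite -/1 => ->; last 2 first.
- lra.
- by move=> w _; exact: cdiff_cst.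
by apply: eq_cmean => [|w _]; [have := cmod_ge0 z; lra|rewrite mul1r].
Qed.

Lemma poisson_le F z b s : cmod z < s < b -> (forall w, cmod w < b -> cdiff F w) ->
  cmod (F z) <= rmean s (fun w => cmod (F w) * poisson s z w).
Proof.
move=> zsb hF; have /andP[zs sb] := zsb.
have s0 : 0 <= s by have := cmod_ge0 z; lra.
have c1 : ccirc s F by apply: (cdiff_circ s0) => w we; apply: hF; rewrite we.
have c2 : rcirc s (poisson s z) by apply: rcirc_poisson; rewrite ?lt_eqF.
rewrite (poisson_formula zsb hF) (le_trans (cmod_cmean _))//.
  by apply: ccircM => //; exact: ccirc_real.
rewrite le_eqVlt; apply/orP; left; apply/eqP; apply: eq_rmean => // w _.
by rewrite cmodM cmod_real ger0_norm// poisson_ge0// ltW.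
Qed.

Lemma max_principle F z m s b : cmod z < s < b -> (forall w, cmod w < b -> cdiff F w) ->
  (forall w, cmod w = s -> cmod (F w) <= m) -> cmod (F z) <= m.
Proof.
move=> zsb hF hm; have /andP[zs sb] := zsb.
have s0 : 0 <= s by have := cmod_ge0 z; lra.
have c1 : ccirc s F by apply: (cdiff_circ s0) => w we; apply: hF; rewrite we.
have c2 : rcirc s (poisson s z) by apply: rcirc_poisson; rewrite ?lt_eqF.
rewrite (le_trans (poisson_le zsb hF))// -[leRHS]mulr1 -(rmean_poisson zs) -rmeanZ//.
apply: le_rmean => //.
- by apply: rcircM => //; exact: rcirc_cmod.
- by apply: rcircM => //; exact: rcirc_cst.
- by move=> w we; rewrite ler_wpM2r ?hm// poisson_ge0// ltW.
Qed.

Definition cauchy_transform s F z := cmean s (fun w => F w * ckernel z w).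

(** F is merely continuous on the circle. Differentiation under the mean rests on the exact
    remainder of the kernel, w h^2/((w - z)^2 (w - z - h)). *)
Lemma cdiff_cauchy_transform s F z : 0 <= s -> cmod z != s -> ccirc s F ->
  cdiff (cauchy_transform s F) z.
Proof.
move=> s0 zs hF; pose D := `|s - cmod z|.
have D0 : 0 < D by rewrite normr_gt0 subr_eq0 eq_sym.
have hD w : cmod w = s -> D <= cmod (w - z) by move=> we; rewrite /D -we; exact: ler_dist_cmod.
pose M := rmean s (fun w => cmod (F w)).
have M0 : 0 <= M by apply: rmean_ge0 => w; exact: cmod_ge0.
have nz h : cmod h < D / 2 -> cmod (z + h) != s.
  move=> hh; apply: contraTneq hh => e; rewrite -leNgt.
  have := hD _ e; rewrite addrC addKr; lra.
apply/cdiffP; exists (cmean s (fun w => F w * (ckernel z w / (w - z)))) => e e0.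
(* The remainder is estimated with |w| = s, |w - z| >= D and |w - z - h| >= D/2. *)
pose C := 2 * s * M / D ^+ 3.
have C0 : 0 <= C.
  by apply: divr_ge0; [apply: mulr_ge0 => //; apply: mulr_ge0|apply/exprn_ge0/ltW].
exists (Num.min (D / 2) (e / (C + 1))).
  by rewrite lt_min !divr_gt0//; lra.
move=> h; rewrite lt_min => /andP[hD2 hC].
have c1 : ccirc s (fun w => F w * ckernel (z + h) w).
  by apply: ccircM => //; apply: ccirc_ckernel => //; exact: nz.
have c2 : ccirc s (fun w => F w * ckernel z w).
  by apply: ccircM => //; apply: ccirc_ckernel.
have c4 : ccirc s (fun w => ckernel z w / (w - z)).
  apply: cdiff_circ => // w we.
  have wz : w != z by apply: cmod_neq; rewrite we eq_sym.
  apply: cdiffM; first exact: cdiff_ckernel.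
  by apply: cdiffV; [rewrite subr_eq0|apply: cdiffB; [exact: cdiff_id|exact: cdiff_cst]].
have c3 : ccirc s (fun w => F w * (ckernel z w / (w - z))) by exact: ccircM.
have c12 : ccirc s (fun w => F w * ckernel (z + h) w - F w * ckernel z w).
  by apply: ccircD => //; exact: ccircN.
have c3' : ccirc s (fun w => h * (F w * (ckernel z w / (w - z)))).
  by apply: ccircM => //; exact: ccirc_cst.
rewrite /cauchy_transform -(cmeanB c1 c2) [_ * h]mulrC -(cmeanZ _ c3) -(cmeanB c12 c3').
have cc := ccircD c12 (ccircN c3').
rewrite (le_trans (cmod_cmean cc))//.
have bd : rmean s (fun w => cmod (F w * ckernel (z + h) w - F w * ckernel z w -
    h * (F w * (ckernel z w / (w - z))))) <= C * cmod h ^+ 2.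
  rewrite (_ : C * _ = 2 * s / D ^+ 3 * cmod h ^+ 2 * M); last by rewrite /C; ring.
  rewrite -rmeanZ; last exact: rcirc_cmod.
  apply: le_rmean => //; first exact: (rcirc_cmod cc).
    by apply: rcircM; [exact: rcirc_cst|exact: rcirc_cmod].
  move=> w we; have wz0 : w - z != 0.
    by rewrite subr_eq0; apply: cmod_neq; rewrite we eq_sym.
  have wzh0 : w - (z + h) != 0.
    by rewrite subr_eq0; apply: cmod_neq; rewrite we eq_sym nz.
  rewrite (_ : _ - _ - _ = F w * (w * h ^+ 2 / ((w - z) ^+ 2 * (w - (z + h))))); last first.
    by rewrite /ckernel; field; rewrite wz0 wzh0.
  rewrite cmodM mulrC ler_wpM2r ?cmod_ge0//.
  rewrite !cmodM cmodV cmodM !cmodX we -expr2.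
  rewrite (_ : 2 * s / D ^+ 3 * _ = s * cmod h ^+ 2 * (D ^+ 2 * (D / 2))^-1); last first.
    by field; rewrite gt_eqF.
  have D3 : 0 < D ^+ 2 * (D / 2) by rewrite mulr_gt0 ?exprn_gt0//; lra.
  apply: ler_wpM2l; first by apply: mulr_ge0 => //; exact: sqr_ge0.
  rewrite lef_pV2 ?posrE//; last first.
    by rewrite mulr_gt0 ?exprn_gt0 ?cmod_gt0.
  have := hD _ we; have := ler_cmodB (w - z) h; rewrite -addrA -opprD => h1 h2.
  apply: ler_pM; [exact: sqr_ge0|lra| |lra].
  by rewrite ler_pXn2r// nnegrE ?cmod_ge0// ltW.
rewrite (le_trans bd)// expr2 mulrA ler_wpM2r ?cmod_ge0//.
rewrite (@le_trans _ _ ((C + 1) * cmod h))//; first by rewrite ler_wpM2r ?cmod_ge0// lerDl.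
by rewrite mulrC -ler_pdivlMr ?ltW//; lra.
Qed.

End CauchyFormula.

(** * Hardy means and Blaschke products *)

Section HardyMeans.
Context (R : realType).
Implicit Types (s t q : R) (z w : R[i]) (f F G : R[i] -> R[i]) (u v : R -> R).

(** Where u is positive the power is exp(q ln u); at a zero of u monotonicity is used, with
    tolerance e^(1/q). *)
Lemma continuous_powR_ge0 u q t : 0 < q -> (forall s, 0 <= u s) ->
  {for t, continuous u} -> {for t, continuous (fun s => u s `^ q)}.
Proof.
move=> q0 u0 hu; have := u0 t; rewrite le_eqVlt => /predU1P[ut|ut].
  apply/continuous_dist => e e0.
  have eq0 : 0 < e `^ q^-1 by rewrite powR_gt0.
  have [d d0 hd] := (iffLR (continuous_dist _ _) hu) _ eq0.
  exists d => // s /hd; rewrite -ut powR0 ?gt_eqF// !subr0 !ger0_norm ?powR_ge0// => us.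
  rewrite -[e]powRr1 ?ltW// -(mulVf (lt0r_neq0 q0)).
  by rewrite powRrM gt0_ltr_powR ?nnegrE ?powR_ge0.
have hc : {for t, continuous (fun s => expR (q * ln (u s)))}.
  apply: (@continuous_comp _ _ _ (fun s => q * ln (u s)) expR); last exact: continuous_expR.
  apply: cvgM; first exact: cvg_cst.
  by apply: (@continuous_comp _ _ _ u (@ln R)); [|exact: continuous_ln].
apply/continuous_dist => e e0.
have [d1 d10 hd1] := (iffLR (continuous_dist _ _) hc) _ e0.
have [d2 d20 hd2] := (iffLR (continuous_dist _ _) hu) _ ut.
exists (Num.min d1 d2); first by rewrite lt_min d10.
move=> s; rewrite lt_min => /andP[/hd1 + /hd2] h2.
have us : 0 < u s by move: h2; rewrite ltr_norml; lra.
by rewrite /powR !gt_eqF.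
Qed.

Lemma rcirc_powR s F q : 0 < q -> ccirc s F -> rcirc s (fun w => cmod (F w) `^ q).
Proof.
move=> q0 hF t ht; apply: continuous_powR_ge0 => //; last exact: (ctn_cmod (hF t ht)).
by move=> t'; exact: cmod_ge0.
Qed.

Lemma hardy_mean s F q : 0 < q -> ccirc s F ->
  poweR ((2 * pi)^-1%:E *
         \int[@lebesgue_measure R]_(t in `[0%R, (2 * pi)%R]%classic)
           (cmod (F (Complex (s * cos t) (s * sin t))) `^ q)%:E)%E q^-1
  = (rmean s (fun w => cmod (F w) `^ q) `^ q^-1)%:E.
Proof.
move=> q0 hF; rewrite -poweR_EFin; congr (poweR _ _).
rewrite /rmean EFinM; congr (_ * _)%E.
rewrite /Ri /Rintegral fineK//; apply: integrable_fin_num => //.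
exact: (ctnR_integrable (rcirc_powR q0 hF)).
Qed.

Lemma powR_le1 (x q : R) : 0 < q -> 0 <= x -> (x `^ q <= 1) = (x <= 1).
Proof.
move=> q0 x0; apply/idP/idP => [|x1].
  rewrite !leNgt; apply: contra => x1.
  have := @gt0_ltr_powR _ _ q0 1 x.
  by rewrite powR1 !nnegrE ler01 x0 => /(_ isT isT x1).
have := @ge0_ler_powR _ _ (ltW q0) x 1.
by rewrite powR1 !nnegrE ler01 x0 => /(_ isT isT x1).
Qed.

(** Only unit balls occur in the interpolation constant, so the outer exponent 1/q and the extended
    reals can be discarded here. *)
Lemma hardy_norm_le1 f q : 0 < q -> Hol f ->
  (hardy_norm q%:E f <= 1)%E <->
  forall s, 0 <= s < 1 -> rmean s (fun w => cmod (f w) `^ q) <= 1.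
Proof.
move=> q0 hf; have c s : 0 <= s < 1 -> ccirc s f.
  move=> /andP[s0 s1]; apply: (cdiff_circ s0) => w we; apply: hf.
  by rewrite /disc /= we.
have r0 s : 0 <= rmean s (fun w => cmod (f w) `^ q).
  by apply: rmean_ge0 => w; exact: powR_ge0.
split => [h s hs|h].
  have := le_trans (ereal_sup_ubound (ex_intro2 _ _ s hs erefl)) h.
  rewrite (hardy_mean q0 (c s hs)) => h1.
  have h2 : ((rmean s (fun w => cmod (f w) `^ q) `^ q^-1)%:E <= 1%:E :> \bar R)%E := h1.
  by rewrite -(@powR_le1 _ q^-1) ?invr_gt0.
apply: ge_ereal_sup => _ [s hs <-]; rewrite (hardy_mean q0 (c s hs)).
suff h2 : ((rmean s (fun w => cmod (f w) `^ q) `^ q^-1)%:E <= 1%:E :> \bar R)%E by [].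
by rewrite lee_fin powR_le1 ?invr_gt0// h.
Qed.

Lemma hardy_norm_inftyP f m : (hardy_norm +oo f <= m%:E)%E <->
  forall z : R[i], disc z -> cmod (f z) <= m.
Proof.
split=> [h z hz|h].
  have := le_trans (ereal_sup_ubound (ex_intro2 _ _ z hz erefl)) h.
  by rewrite lee_fin.
by apply: ge_ereal_sup => _ [z hz <-]; rewrite lee_fin h.
Qed.

(* The kernel bound C A^q plays the role of 1/(1-|w|); the pointwise inequality
   x <= A + A (x/A)^q replaces Jensen's inequality. *)
Lemma hardy_growth f q s w A C : 1 <= q -> cmod w < s < 1 -> Hol f -> 0 < A -> 0 <= C ->
  rmean s (fun w => cmod (f w) `^ q) <= 1 ->
  (forall z, cmod z = s -> poisson s w z <= C * A `^ q) ->
  cmod (f w) <= (1 + C) * A.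
Proof.
move=> q1 ws hf A0 C0 hm hC; have /andP[ws1 s1] := ws.
have q0 : 0 < q by rewrite (lt_le_trans ltr01).
have s0 : 0 <= s by rewrite ltW// (le_lt_trans (cmod_ge0 w)).
have c1 : ccirc s f by apply: (cdiff_circ s0) => z ze; apply: hf; rewrite /disc /= ze.
have c2 : rcirc s (poisson s w) by apply: rcirc_poisson; rewrite ?lt_eqF.
have c3 := rcirc_powR q0 c1.
have Aq : 0 < A `^ q by rewrite powR_gt0.
rewrite (le_trans (poisson_le ws hf))//.
have -> : (1 + C) * A = rmean s (fun z => A * poisson s w z) + A * C.
  by rewrite (rmeanZ _ c2) rmean_poisson//; ring.
apply: (@le_trans _ _ (rmean s (fun z => A * poisson s w z) +
    rmean s (fun z => A * C * cmod (f z) `^ q))); last first.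
  by rewrite lerD2l (rmeanZ _ c3) ler_piMr// mulr_ge0// ltW.
have c4 := rcircM (@rcirc_cst R s A) c2; have c5 := rcircM (@rcirc_cst R s (A * C)) c3.
rewrite -(rmeanD c4 c5); apply: le_rmean => //.
- by apply: rcircM => //; exact: rcirc_cmod.
- exact: rcircD.
move=> z ze; set x := cmod (f z); have x0 : 0 <= x by exact: cmod_ge0.
have P0 : 0 <= poisson s w z by apply: poisson_ge0; exact: ltW.
have hx : x <= A + A * (x / A) `^ q.
  have [xA|xA] := leP x A; first by rewrite ler_wpDr// mulr_ge0 ?powR_ge0 ?ltW.
  have xA1 : 1 <= x / A by rewrite ler_pdivlMr// mul1r ltW.
  have := ler_powR xA1 q1; rewrite powRr1 ?divr_ge0 ?(ltW A0)// => h.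
  rewrite ler_wpDl ?(ltW A0)// (le_trans _ (ler_wpM2l (ltW A0) h))//.
  by rewrite mulrC divfK ?gt_eqF.
apply: (le_trans (ler_wpM2r P0 hx)); rewrite mulrDl lerD2l.
have -> : (x / A) `^ q = x `^ q / A `^ q.
  rewrite powRM ?invr_ge0 ?(ltW A0)//; congr (_ * _).
  by rewrite -(powR_inv1 (ltW A0)) -powRrM mulN1r powRN.
have -> : A * (x `^ q / A `^ q) * poisson s w z = A * (x `^ q * (poisson s w z / A `^ q)).
  by ring.
have -> : A * C * x `^ q = A * (x `^ q * C) by ring.
apply: (ler_wpM2l (ltW A0)); apply: ler_wpM2l; first exact: powR_ge0.
rewrite ler_pdivrMr//.
exact: hC.
Qed.

End HardyMeans.

(** * Blaschke factors and products on the disc *)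

Section Blaschke.
Context (R : realType).
Implicit Types (z w l : R[i]) (r s : R).

Lemma blaschke_den_neq0 l z : cmod l < 1 -> cmod z < 1 -> 1 - (l^*)%C * z != 0.
Proof.
move=> l1 z1; rewrite subr_eq0; apply: cmod_neq; rewrite cmod1 cmodM cmodJ gt_eqF//.
by rewrite (le_lt_trans (ler_piMr (cmod_ge0 _) (ltW z1))).
Qed.

Lemma cdiff_blaschke_factor l z : cmod l < 1 -> cmod z < 1 -> cdiff (blaschke_factor l) z.
Proof.
move=> l1 z1; apply: cdiffM.
  by apply: cdiffB; [exact: cdiff_cst|exact: cdiff_id].
apply: cdiffV; first exact: blaschke_den_neq0.
apply: cdiffB; first exact: cdiff_cst.
by apply: cdiffM; [exact: cdiff_cst|exact: cdiff_id].
Qed.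

Lemma blaschke_factor_identity l z : cmod l < 1 -> cmod z < 1 ->
  1 - cmod (blaschke_factor l z) ^+ 2 =
  (1 - cmod l ^+ 2) * (1 - cmod z ^+ 2) / cmod (1 - (l^*)%C * z) ^+ 2.
Proof.
move=> l1 z1; have d0 : cmod (1 - (l^*)%C * z) ^+ 2 != 0.
  by rewrite expf_neq0// cmod_eq0 blaschke_den_neq0.
rewrite /blaschke_factor cmodM cmodV exprMn exprVn.
rewrite -[1 in LHS](divff d0) -mulrBl; congr (_ / _).
rewrite !sqr_cmod; case: l z {l1 z1 d0} => [a b] [x y] /=; ring.
Qed.

Lemma blaschke_factor_lt1 l z : cmod l < 1 -> cmod z < 1 -> cmod (blaschke_factor l z) < 1.
Proof.
move=> l1 z1; have := blaschke_factor_identity l1 z1.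
have d0 : 0 < cmod (1 - (l^*)%C * z) by rewrite cmod_gt0 blaschke_den_neq0.
have cl := cmod_ge0 l; have cz := cmod_ge0 z.
have h1 : 0 < 1 - cmod l ^+ 2 by nra.
have h2 : 0 < 1 - cmod z ^+ 2 by nra.
have : 0 < (1 - cmod l ^+ 2) * (1 - cmod z ^+ 2) / cmod (1 - (l^*)%C * z) ^+ 2.
  by rewrite divr_gt0 ?mulr_gt0 ?exprn_gt0.
move=> h0 e; rewrite -e in h0; have := cmod_ge0 (blaschke_factor l z); nra.
Qed.

(** In the identity for 1 - |b|^2, bound 1 - |l|^2 by 2(1 - |l|), 1 - s^2 by 2(1 - s), and the
    denominator from below by (1 - |l|)^2. *)
Lemma blaschke_factor_lower l z r s : 0 <= r -> cmod l <= r -> r < 1 -> cmod z = s -> s < 1 ->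
  1 - 4 * (1 - s) / (1 - r) <= cmod (blaschke_factor l z) ^+ 2.
Proof.
move=> r0 lr r1 ze s1; have cl := cmod_ge0 l; have cz := cmod_ge0 z.
have l1 : cmod l < 1 by lra.
have z1 : cmod z < 1 by lra.
have := blaschke_factor_identity l1 z1.
have hd : 1 - cmod l <= cmod (1 - (l^*)%C * z).
  have := ler_cmodB 1 ((l^*)%C * z); rewrite cmod1 cmodM cmodJ => h.
  by apply: le_trans h; nra.
have lp : 0 < 1 - cmod l by lra.
have d0 : 0 < cmod (1 - (l^*)%C * z) by lra.
suff : (1 - cmod l ^+ 2) * (1 - cmod z ^+ 2) / cmod (1 - (l^*)%C * z) ^+ 2
    <= 4 * (1 - s) / (1 - r) by lra.
rewrite ler_pdivrMr ?exprn_gt0//.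
apply: (@le_trans _ _ (4 * (1 - s) / (1 - cmod l) * (1 - cmod l) ^+ 2)).
  rewrite (_ : 4 * (1 - s) / (1 - cmod l) * (1 - cmod l) ^+ 2 = 4 * (1 - s) * (1 - cmod l)).
    rewrite ze (_ : _ * _ = (1 + cmod l) * (1 + s) * ((1 - s) * (1 - cmod l))); last by ring.
    rewrite -[leRHS]mulrA ler_wpM2r ?mulr_ge0//; [lra|lra|nra].
  by field; lra.
apply: ler_pM.
- by rewrite divr_ge0 ?mulr_ge0//; lra.
- exact: sqr_ge0.
- rewrite ler_wpM2l ?mulr_ge0//; first by lra.
  by rewrite lef_pV2 ?posrE//; lra.
- by rewrite ler_pXn2r ?nnegrE//; lra.
Qed.

Lemma cdiff_blaschke sigma r z : r < 1 -> (forall l, l \in sigma -> cmod l <= r) ->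
  cmod z < 1 -> cdiff (blaschke sigma) z.
Proof.
move=> r1 hs z1; apply: cdiff_prod => l /hs lr.
by apply: cdiff_blaschke_factor => //; exact: le_lt_trans r1.
Qed.

Lemma blaschke_le1 sigma r z : r < 1 -> (forall l, l \in sigma -> cmod l <= r) ->
  cmod z < 1 -> cmod (blaschke sigma z) <= 1.
Proof.
rewrite /blaschke => r1; elim: sigma => [|l sigma IH] hs z1; first by rewrite big_nil cmod1.
rewrite big_cons cmodM mulr_ile1 ?cmod_ge0//.
  by rewrite ltW// blaschke_factor_lt1// (le_lt_trans _ r1)// hs// mem_head.
by apply: IH => // l' l's; rewrite hs// inE l's orbT.
Qed.

Lemma blaschke_neq0 sigma r z : r < 1 -> (forall l, l \in sigma -> cmod l <= r) ->
  r < cmod z < 1 -> blaschke sigma z != 0.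
Proof.
move=> r1 hs /andP[rz z1]; rewrite /blaschke prodf_seq_neq0; apply/allP => l /hs lr /=.
rewrite mulf_neq0 ?invr_eq0 ?blaschke_den_neq0//; last exact: le_lt_trans r1.
by rewrite subr_eq0; apply: cmod_neq; rewrite lt_eqF// (le_lt_trans lr).
Qed.

(** The inequality (1 - c)^k >= 1 - kc in product form, by induction on the points; [blaschke_le1]
    keeps the error additive. *)
Lemma blaschke_lower sigma r z (c : R) : 0 <= r -> r < 1 ->
  (forall l, l \in sigma -> cmod l <= r) -> cmod z < 1 ->
  4 * (1 - cmod z) / (1 - r) <= c -> c <= 1 ->
  1 - (size sigma)%:R * c <= cmod (blaschke sigma z) ^+ 2.
Proof.
rewrite /blaschke => r0 r1 hs z1 hc c1.
have c0 : 0 <= c by rewrite (le_trans _ hc)// divr_ge0 ?mulr_ge0//; lra.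
elim: sigma hs => [|l sigma IH] hs; first by rewrite big_nil cmod1 mul0r subr0 expr1n.
rewrite big_cons cmodM exprMn /=.
have h1 := blaschke_factor_lower r0 (hs l (mem_head _ _)) r1 erefl z1.
have h2 : 1 - (size sigma)%:R * c <= cmod (\prod_(l <- sigma) blaschke_factor l z) ^+ 2.
  by apply: IH => l' l's; rewrite hs// inE l's orbT.
have h3 : cmod (\prod_(l <- sigma) blaschke_factor l z) ^+ 2 <= 1.
  rewrite expr_le1 ?cmod_ge0// (@blaschke_le1 _ r)// => l' l's.
  by rewrite hs// inE l's orbT.
have h4 := sqr_ge0 (cmod (\prod_(l <- sigma) blaschke_factor l z)).
rewrite -natr1 mulrDl mul1r.
move: h1 h2 h3 h4; set X := cmod (blaschke_factor l z) ^+ 2.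
set Y := cmod _ ^+ 2; move=> h1 h2 h3 h4.
have h5 : 1 - c <= X by lra.
by apply: (@le_trans _ _ ((1 - c) * Y)); [nra|rewrite ler_wpM2r].
Qed.

End Blaschke.

(** * Upper bound *)

Section Interpolation.
Context (R : realType).
Implicit Types (z w l : R[i]) (r s : R) (F f : R[i] -> R[i]).

Lemma rmean_inv_dist2 s z : cmod z < s ->
  rmean s (fun w => (cmod (w - z) ^+ 2)^-1) = (s ^+ 2 - cmod z ^+ 2)^-1.
Proof.
move=> zs; have z0 := cmod_ge0 z; have s0 : 0 <= s by lra.
have k0 : s ^+ 2 - cmod z ^+ 2 != 0 by rewrite gt_eqF//; nra.
have c : rcirc s (poisson s z) by apply: rcirc_poisson; rewrite ?lt_eqF.
rewrite -[RHS]mulr1 -(rmean_poisson zs) -(rmeanZ _ c); apply: eq_rmean => // w _.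
by rewrite /poisson mulKf.
Qed.

(* Analytic part of the Laurent decomposition of F in the annulus r < |z| < 1. *)
Definition inner_part r F z := cauchy_transform ((1 + Num.max (cmod z) r) / 2) F z.

Section Annulus.
Context (r : R) (F : R[i] -> R[i]).
Context (r0 : 0 <= r) (r1 : r < 1) (hF : forall w, r < cmod w < 1 -> cdiff F w).

(** The radius in [inner_part] varies with z. Independence of the radius lets one fixed circle serve
    all points near z, which yields differentiability. *)
Lemma inner_partE z s : cmod z < s -> r < s -> s < 1 ->
  cauchy_transform s F z = inner_part r F z.
Proof.
move=> zs rs s1; rewrite /inner_part /cauchy_transform.
have m1 : Num.max (cmod z) r < 1 by rewrite gt_max r1 andbT (lt_trans zs).
have m0 : 0 <= Num.max (cmod z) r by rewrite le_max r0 orbT.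
have ms : Num.max (cmod z) r < s by rewrite gt_max zs.
apply: (cmean_annulus m0 (b := 1)); [lra|lra|].
move=> w /andP[]; rewrite gt_max => /andP[zw rw] w1.
apply: cdiffM; first by apply: hF; rewrite rw.
by apply: cdiff_ckernel; apply: cmod_neq; rewrite gt_eqF.
Qed.

Lemma annulus_circ s : r < s < 1 -> ccirc s F.
Proof.
move=> /andP[rs s1]; apply: cdiff_circ => [|w we]; first by rewrite ltW// (le_lt_trans r0).
by apply: hF; rewrite we rs.
Qed.

Lemma cdiff_inner_part z : cmod z < 1 -> cdiff (inner_part r F) z.
Proof.
move=> z1; pose s := (1 + Num.max (cmod z) r) / 2.
have m1 : Num.max (cmod z) r < 1 by rewrite gt_max z1.
have mz : cmod z <= Num.max (cmod z) r by rewrite le_max lexx.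
have mr : r <= Num.max (cmod z) r by rewrite le_max lexx orbT.
have s1 : s < 1 by rewrite /s; lra.
have zs : cmod z < s by rewrite /s; lra.
have rs : r < s by rewrite /s; lra.
have d0 : 0 < s - cmod z by lra.
apply: (cdiff_near d0 (f := cauchy_transform s F)).
  move=> w hw; apply: inner_partE => //.
  by have := ler_cmodB w z; lra.
apply: cdiff_cauchy_transform; [exact/ltW/(le_lt_trans r0)|by rewrite lt_eqF|].
by apply: annulus_circ; rewrite rs.
Qed.

Lemma laurent_decomposition s z : r < s -> s < cmod z -> cmod z < 1 ->
  inner_part r F z - cauchy_transform s F z = F z.
Proof.
move=> rs sz z1; pose s' := (1 + Num.max (cmod z) r) / 2.
have m : Num.max (cmod z) r = cmod z by apply/max_idPl; lra.
have zs' : cmod z < s' by rewrite /s' m; lra.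
have s'1 : s' < 1 by rewrite /s' m; lra.
rewrite -(@inner_partE z s')//; last by lra.
by apply: (@cauchy_jump _ F z r 1); rewrite ?rs ?sz ?zs' ?s'1.
Qed.

End Annulus.

(** The two kernels combine to w^2 (1 - rho^2)/((w - z)(w - rho^2 z)). Since |z| - rho >= (1 -
    rho)/2, one has 1 - rho^2 <= 2(1 - rho) <= 4|w - z|, so |w - rho^2 z| <= 5|w - z|. The factor |w
    - z| is traded for the other one, because the mean of |w - rho^2 z|^(-2) is explicit. *)
Lemma jones_kernel_bound (rho : R) z w : 0 < rho < 1 -> cmod w = rho -> (1 + rho) / 2 <= cmod z < 1 ->
  cmod (ckernel z w - (rho ^+ 2)%:C * ckernel ((rho ^+ 2)%:C * z) w) <=
  5 * rho ^+ 2 * (1 - rho ^+ 2) * (cmod (w - (rho ^+ 2)%:C * z) ^+ 2)^-1.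
Proof.
move=> /andP[rho0 rho1] we /andP[z1 z2]; have z0 := cmod_ge0 z.
set q := (rho ^+ 2)%:C * z.
have cq : cmod q = rho ^+ 2 * cmod z by rewrite cmodM cmod_real ger0_norm ?sqr_ge0.
have r2 : rho ^+ 2 < rho by nra.
have r20 : 0 < rho ^+ 2 by nra.
have qr : cmod q < rho by rewrite cq; nra.
have wz : w - z != 0 by rewrite subr_eq0; apply: cmod_neq; rewrite we lt_eqF//; lra.
have wq : w - q != 0 by rewrite subr_eq0; apply: cmod_neq; rewrite we gt_eqF.
have cwz : 0 < cmod (w - z) by rewrite cmod_gt0.
have cwq : 0 < cmod (w - q) by rewrite cmod_gt0.
have -> : ckernel z w - (rho ^+ 2)%:C * ckernel q w =
    w ^+ 2 * (1 - rho ^+ 2)%:C / ((w - z) * (w - q)).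
  have -> : (1 - rho ^+ 2)%:C = 1 - (rho ^+ 2)%:C :> R[i] by rewrite rmorphB.
  move: wq; rewrite /q.
  by move: (rho ^+ 2)%:C => p wp; rewrite /ckernel; field; rewrite wz wp.
have h0 : 0 <= 1 - rho ^+ 2 by nra.
rewrite !cmodM cmodV cmodM we cmod_real ger0_norm//.
have h1 : cmod (w - q) <= 5 * cmod (w - z).
  have := cmodD (w - z) ((1 - rho ^+ 2)%:C * z).
  rewrite (_ : w - z + _ = w - q); last by rewrite /q rmorphB rmorph1; ring.
  rewrite [cmod (_ * z)]cmodM cmod_real ger0_norm// => h.
  have := ler_cmodB z w; rewrite cmodC we => h2; nra.
rewrite -expr2 (_ : 5 * rho ^+ 2 * _ * _ =
  rho ^+ 2 * (1 - rho ^+ 2) * (5 * (cmod (w - q) ^+ 2)^-1)); last by ring.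
apply: ler_wpM2l; first by rewrite mulr_ge0// ltW.
rewrite invfM expr2 invfM mulrA ler_pM2r ?invr_gt0//.
by rewrite ler_pdivlMr// ler_pdivrMl// mulrC.
Qed.

(* Jones-type solution of the division problem: the measure (f/B) dw on |w| = rho is solved
   with the Cauchy kernel multiplied by (1 - rho^2)/(1 - w^* z), whose modulus on the unit
   circle is a Poisson kernel. *)
Lemma bounded_interpolation f B r (rho M : R) : 0 <= r -> r < rho -> rho < 1 ->
  (forall z, cmod z < 1 -> cdiff f z) -> (forall z, cmod z < 1 -> cdiff B z) ->
  (forall z, cmod z < 1 -> cmod (B z) <= 1) -> (forall z, r < cmod z < 1 -> B z != 0) ->
  (forall w, cmod w = rho -> cmod (f w / B w) <= M) ->
  exists g h, [/\ forall z, cmod z < 1 -> cdiff g z, forall z, cmod z < 1 -> cdiff h z,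
    forall z, f z - g z = B z * h z & forall z, cmod z < 1 -> cmod (g z) <= 5 * M].
Proof.
move=> r0 rrho rho1 hf hB B1 B0 hM.
have rho0 : 0 < rho by lra.
have r1 : r < 1 by lra.
pose F w := f w / B w.
have hF w : r < cmod w < 1 -> cdiff F w.
  move=> hw; have w1 : cmod w < 1 by case/andP: hw.
  by apply: cdiffM; [exact: hf|apply: cdiffV; [exact: B0|exact: hB]].
pose q z := (rho ^+ 2)%:C * z.
have r20 : 0 < rho ^+ 2 by nra.
have r21 : rho ^+ 2 < rho by nra.
have cq z : cmod (q z) = rho ^+ 2 * cmod z.
  by rewrite cmodM cmod_real ger0_norm ?sqr_ge0.
have q1 z : cmod z < 1 -> cmod (q z) < rho by rewrite cq => ?; have := cmod_ge0 z; nra.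
have dq z : cdiff q z by apply: cdiffM; [exact: cdiff_cst|exact: cdiff_id].
pose h z := inner_part r F z - (rho ^+ 2)%:C * inner_part r F (q z).
have hh z : cmod z < 1 -> cdiff h z.
  move=> z1; apply: cdiffB; first exact: cdiff_inner_part.
  apply: cdiffM; first exact: cdiff_cst.
  apply: (cdiff_comp (dq z)); apply: cdiff_inner_part => //.
  exact: lt_trans (q1 _ z1) rho1.
pose g z := f z - B z * h z.
have hg z : cmod z < 1 -> cdiff g z.
  move=> z1; apply: cdiffB; first exact: hf.
  by apply: cdiffM; [exact: hB|exact: hh].
exists g, h; split => //; first by move=> z; rewrite /g; ring.
have M0 : 0 <= M by apply: le_trans (hM rho%:C _); [exact: cmod_ge0|rewrite cmod_real gtr0_norm].
(* The estimate is made near the unit circle only; the maximum principle carries it inside at the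
   end. *)
have bd z : (1 + rho) / 2 <= cmod z < 1 -> cmod (g z) <= 5 * M.
  move=> /andP[z1 z2]; have rz : rho < cmod z by lra.
  have cF : ccirc rho F by apply: (annulus_circ r0 hF); rewrite rrho.
  have qz : cmod (q z) < rho by exact: q1.
  have cz : ccirc rho (ckernel z) by apply: ccirc_ckernel; rewrite ?gt_eqF// ltW.
  have cqz : ccirc rho (ckernel (q z)) by apply: ccirc_ckernel; rewrite ?lt_eqF// ltW.
  have c1 := ccircM cF cz; have c2 := ccircM cF cqz.
  have c3 := ccircM (@ccirc_cst R rho (rho ^+ 2)%:C) c2.
  (* By the Laurent decomposition, f - B F+ is -B times the Cauchy transform over |w| = rho. The
     point rho^2 z lies inside that circle, so F+ at it is a transform over the same circle. *)
  have -> : g z = - B z * cmean rho (fun w => F w *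
      (ckernel z w - (rho ^+ 2)%:C * ckernel (q z) w)).
    rewrite (@eq_cmean _ _ _ (fun w => F w * ckernel z w -
      (rho ^+ 2)%:C * (F w * ckernel (q z) w)) (ltW rho0)); last by move=> w _; ring.
    rewrite (cmeanB c1 c3) (cmeanZ _ c2).
    rewrite -/(cauchy_transform rho F z) -/(cauchy_transform rho F (q z)).
    rewrite (inner_partE r0 r1 hF qz rrho rho1).
    have e := laurent_decomposition r0 r1 hF rrho rz z2.
    rewrite /g /h (_ : f z = B z * F z).
      by rewrite -{1}e; ring.
    by rewrite /F mulrC divfK// B0// z2 andbT; lra.
  rewrite cmodM cmodN -[leRHS]mul1r; apply: ler_pM; rewrite ?cmod_ge0 ?B1//.
  have c4 : ccirc rho (fun w => ckernel z w - (rho ^+ 2)%:C * ckernel (q z) w).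
    by apply: ccircD => //; apply: ccircN; apply: ccircM => //; exact: ccirc_cst.
  have c5 := ccircM cF c4.
  have c6 : rcirc rho (fun w => (cmod (w - q z) ^+ 2)^-1).
    have c : rcirc rho (fun w => cmod (w - q z)).
      by apply: rcirc_cmod; apply: ccircD; [exact: ccirc_id|exact: ccirc_cst].
    apply: rcirc_inv; [by apply: (rcircM c c)| |exact: ltW].
    move=> w we; rewrite expf_neq0// cmod_eq0 subr_eq0; apply: cmod_neq.
    by rewrite we gt_eqF.
  rewrite (le_trans (cmod_cmean c5))//.
  apply: (@le_trans _ _ (rmean rho (fun w => M * (5 * rho ^+ 2 * (1 - rho ^+ 2)) *
      (cmod (w - q z) ^+ 2)^-1))).
    apply: le_rmean; first exact: ltW.
    - exact: rcirc_cmod.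
    - by apply: rcircM => //; exact: rcirc_cst.
    move=> w we; rewrite cmodM -mulrA; apply: ler_pM; rewrite ?cmod_ge0//; first exact: hM.
    by apply: jones_kernel_bound => //; [rewrite rho0|rewrite z1].
  (* The mean equals 5M (1 - rho^2)/(1 - rho^2 |z|^2), which is at most 5M because |z| <= 1. *)
  rewrite (rmeanZ _ c6) rmean_inv_dist2// cq.
  rewrite -mulrA [5 * M]mulrC; apply: ler_wpM2l => //.
  have := cmod_ge0 z => z0.
  have z2' : cmod z ^+ 2 <= 1 by nra.
  rewrite (_ : rho ^+ 2 - _ = rho ^+ 2 * (1 - rho ^+ 2 * cmod z ^+ 2)); last by ring.
  have p0 : 0 < 1 - rho ^+ 2 * cmod z ^+ 2 by nra.
  by rewrite ler_pdivrMr ?mulr_gt0//; nra.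
move=> z z1; pose s := Num.max ((1 + rho) / 2) ((1 + cmod z) / 2).
have s1 : s < 1 by rewrite gt_max; lra.
have zs : cmod z < s by rewrite lt_max; apply/orP; right; lra.
apply: (@max_principle _ g z (5 * M) s 1); rewrite ?zs//.
by move=> w we; apply: bd; rewrite we s1 le_max lexx.
Qed.

(** On the chosen circle |B|^2 >= 1/2, hence |B| >= 1/2 and |f/B| <= 66 A; the kernel multiplies
    this by 5. *)
Lemma hardy_interpolation f (sigma : seq R[i]) (n : nat) r A : (1 <= n)%N -> 0 <= r < 1 ->
  (size sigma <= n)%N -> (forall l, l \in sigma -> cmod l <= r) -> Hol f -> 0 <= A ->
  (forall w, cmod w = 1 - (1 - r) / (8 * n%:R) -> cmod (f w) <= 33 * A) ->
  exists g, [/\ Hol g, agree_on sigma g f & forall z, disc z -> cmod (g z) <= 330 * A].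
Proof.
move=> n1 /andP[r0 r1] sn hs hf A0; set rho := 1 - _ => hA.
have n0 : 0 < n%:R :> R by rewrite ltr0n.
have n1' : 1 <= n%:R :> R by rewrite ler1n.
have rr : 0 < (1 - r) / (8 * n%:R) by rewrite divr_gt0 ?mulr_gt0//; lra.
have rr2 : (1 - r) / (8 * n%:R) <= (1 - r) / 8.
  by rewrite ler_pM2l ?lef_pV2 ?posrE ?mulr_gt0//; lra.
have rrho : r < rho by rewrite /rho; lra.
have rho1 : rho < 1 by rewrite /rho; lra.
have hB w : cmod w = rho -> cmod (f w / blaschke sigma w) <= 66 * A.
  move=> we.
  have B1 : cmod (blaschke sigma w) <= 1 by apply: (blaschke_le1 r1 hs); rewrite we.
  have Bn : blaschke sigma w != 0 by apply: (blaschke_neq0 r1 hs); rewrite we rrho.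
  have B0 : 0 < cmod (blaschke sigma w) by rewrite cmod_gt0.
  have hc : 4 * (1 - cmod w) / (1 - r) <= 1 / (2 * n%:R).
    rewrite we /rho le_eqVlt; apply/orP; left; apply/eqP.
    by field; rewrite ?gt_eqF//; lra.
  have hc1 : 1 / (2 * n%:R) <= 1 :> R by rewrite ler_pdivrMr ?mulr_gt0//; lra.
  have := blaschke_lower r0 r1 hs (_ : cmod w < 1) hc hc1; rewrite we => /(_ rho1).
  have : (size sigma)%:R * (1 / (2 * n%:R)) <= 1 / 2 :> R.
    rewrite (_ : 1 / 2 = n%:R * (1 / (2 * n%:R))); last by field; rewrite gt_eqF.
    by rewrite ler_wpM2r ?ler_nat// divr_ge0// mulr_ge0// ltW.
  move=> h1 h2; rewrite cmodM cmodV ler_pdivrMr//.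
  apply: le_trans (hA _ we) _.
  have : 1 / 2 <= cmod (blaschke sigma w) by nra.
  by nra.
have hf' z : cmod z < 1 -> cdiff f z by exact: hf.
have hd z : cmod z < 1 -> cdiff (blaschke sigma) z by exact: cdiff_blaschke hs.
have hl z : cmod z < 1 -> cmod (blaschke sigma z) <= 1 by exact: blaschke_le1 hs.
have hn z : r < cmod z < 1 -> blaschke sigma z != 0 by exact: blaschke_neq0 hs.
have [g [h [dg dh fg bg]]] := bounded_interpolation r0 rrho rho1 hf' hd hl hn hB.
exists g; split; [exact: dg|by exists h; [exact: dh|move=> z _; exact: fg]|].
by move=> z z1; apply: (le_trans (bg z z1)); lra.
Qed.

Lemma Cnr_upper (p : \bar R) (n : nat) r : (1%:E <= p)%E -> (1 <= n)%N -> 0 <= r < 1 ->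
  (Cnr n r (Hardy p) (Hardy +oo) <= (330 * (n%:R / (1 - r)) `^ (fine (p^-1)%E))%:E)%E.
Proof.
move=> p1 n1 r01; have /andP[r0 r1] := r01.
have n0 : 0 < n%:R :> R by rewrite ltr0n.
have n1' : 1 <= n%:R :> R by rewrite ler1n.
pose T := n%:R / (1 - r); have T0 : 0 < T by rewrite divr_gt0//; lra.
pose A := T `^ (fine (p^-1)%E).
have A0 : 0 < A by rewrite powR_gt0.
pose rho := 1 - (1 - r) / (8 * n%:R).
have rr : 0 < (1 - r) / (8 * n%:R) by rewrite divr_gt0 ?mulr_gt0//; lra.
have rr2 : (1 - r) / (8 * n%:R) <= (1 - r) / 8.
  by rewrite ler_pM2l ?lef_pV2 ?posrE ?mulr_gt0//; lra.
have rho1 : rho < 1 by rewrite /rho; lra.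
have rho0 : 0 < rho by rewrite /rho; lra.
have growth f : Hol f -> (hardy_norm p f <= 1)%E ->
    forall w, cmod w = rho -> cmod (f w) <= 33 * A.
  move=> hf; rewrite /A; case: p p1 {A A0} => [q q1|_|//].
    rewrite fine_invr; have q1' : 1 <= q by rewrite -lee_fin.
    have q0 : 0 < q by lra.
    move/(hardy_norm_le1 q0 hf) => hm w we.
    (* The Poisson kernel is at most (s + rho)/(s - rho) <= 2/(s - rho), and s - rho = 1/(16 T), so
       it is at most 32 T. Thus [hardy_growth] applies with C = 32, which gives 33. *)
    pose s := (1 + rho) / 2.
    have ws : cmod w < s < 1 by rewrite we /s; lra.
    have s01 : 0 <= s < 1 by rewrite /s; lra.
    have -> : 33 = 1 + 32 :> R by lra.
    apply: (hardy_growth q1' ws hf) => //; [exact: powR_gt0|exact: hm|].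
    move=> z ze; rewrite -powRrM mulVf ?gt_eqF// (powRr1 (ltW T0)).
    have hd : s - rho <= cmod (z - w) by have := ler_cmodB z w; rewrite ze we.
    have sr : 0 < s - rho by rewrite /s; lra.
    rewrite /poisson we ler_pdivrMr ?exprn_gt0//; last exact: lt_le_trans hd.
    apply: (@le_trans _ _ (32 * T * (s - rho) ^+ 2)); last first.
      apply: ler_wpM2l; first by rewrite mulr_ge0// ltW.
      by rewrite ler_pXn2r// nnegrE ?cmod_ge0// ltW.
    have e : 32 * T * (s - rho) = 2.
      by rewrite /T /s /rho; field; rewrite !gt_eqF//; lra.
    rewrite (_ : 32 * T * (s - rho) ^+ 2 = 2 * (s - rho)); last by rewrite -e; ring.
    by rewrite /s in sr *; nra.
  (* For p = +oo the exponent is 0, so A = 1 and the bound |f| <= 1 suffices. *)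
  move=> h w we; rewrite [fine _](_ : _ = 0)// powRr0 mulr1.
  have := (iffLR (hardy_norm_inftyP f 1)) h w.
  by rewrite /disc /= we => /(_ rho1) ?; lra.
apply: ge_ereal_sup => _ [sigma [sn hs] <-].
apply: ge_ereal_sup => _ [f [[hf fp] f1] <-].
have [g [dg ag bg]] := hardy_interpolation n1 r01 sn hs hf (ltW A0) (growth f hf f1).
have hg : (hardy_norm +oo g <= (330 * A)%:E)%E by apply/hardy_norm_inftyP.
apply: le_trans hg; apply: ereal_inf_lbound; exists g => //; split => //; split => //.
by apply: (@le_lt_trans _ _ (330 * A)%:E); [apply/hardy_norm_inftyP|exact: ltry].
Qed.

End Interpolation.

(** * Roots on the right half-plane *)

Section ComplexRoot.
Context (R : realType).
Implicit Types (z w : R[i]) (F G : R[i] -> R[i]) (u v : R[i] -> R).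

Definition ccontR u z := forall e : R, 0 < e -> exists2 d : R, 0 < d &
  forall w, cmod (w - z) < d -> `|u w - u z| < e.

Lemma ccontR_comp u (phi : R -> R) z : ccontR u z -> {for u z, continuous phi} ->
  ccontR (fun w => phi (u w)) z.
Proof.
move=> hu /continuous_dist hphi e /hphi[d /hu[d' d'0 hd'] hd]; exists d' => // w.
by move=> /hd'/hd.
Qed.

Lemma ccont_comp F G z : ccont F z -> ccont G (F z) -> ccont (fun w => G (F w)) z.
Proof.
by move=> hF hG e /hG[d /hF[d' d'0 hd'] hd]; exists d' => // w /hd'/hd.
Qed.

Lemma ccont_ReIm u v z : ccontR u z -> ccontR v z -> ccont (fun w => Complex (u w) (v w)) z.
Proof.
move=> hu hv e e0; have e2 : 0 < e / 2 by lra.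
have [d1 d10 hd1] := hu _ e2; have [d2 d20 hd2] := hv _ e2.
exists (Num.min d1 d2); first by rewrite lt_min d10.
move=> w; rewrite lt_min => /andP[/hd1 h1 /hd2 h2].
rewrite (le_lt_trans (cmod_le_ReIm _))//=; lra.
Qed.

Lemma ccontR_Re z : ccontR (fun w => complex.Re w) z.
Proof.
move=> e e0; exists e => // w; apply: le_lt_trans.
by rewrite (le_trans _ (Re_le_cmod _))// ReD ReN.
Qed.

Lemma ccontR_Im z : ccontR (fun w => complex.Im w) z.
Proof.
move=> e e0; exists e => // w; apply: le_lt_trans.
by rewrite (le_trans _ (Im_le_cmod _))// ImD ImN.
Qed.

Lemma ccontR_cmod z : ccontR (fun w => cmod w) z.
Proof. by move=> e e0; exists e => // w; apply: le_lt_trans; exact: ler_dist_cmod. Qed.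

Lemma ccontRM u v z : ccontR u z -> ccontR v z -> ccontR (fun w => u w * v w) z.
Proof.
move=> hu hv e e0; pose M := `|u z| + `|v z| + 2.
have u0 := normr_ge0 (u z); have v0 := normr_ge0 (v z).
have M0 : 0 < M by rewrite /M; lra.
have e1 : 0 < Num.min 1 (e / (2 * M)) by rewrite lt_min ltr01 divr_gt0// mulr_gt0.
have [d1 d10 hd1] := hu _ e1; have [d2 d20 hd2] := hv _ e1.
exists (Num.min d1 d2); first by rewrite lt_min d10.
move=> s; rewrite lt_min => /andP[/hd1 + /hd2]; rewrite !lt_min => /andP[f1 f2] /andP[g1 g2].
rewrite (_ : _ - _ = u s * (v s - v z) + v z * (u s - u z)); last by ring.
rewrite (le_lt_trans (ler_normD _ _))// !normrM.
have cs : `|u s| <= M.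
  by have := ler_normD (u s - u z) (u z); rewrite subrK /M; lra.
rewrite (_ : e = M * (e / (2 * M)) + M * (e / (2 * M))); last by field; rewrite gt_eqF.
have gM : `|v z| <= M by rewrite /M; lra.
apply: ltr_leD.
  by apply: (@le_lt_trans _ _ (M * `|v s - v z|)); [rewrite ler_wpM2r|rewrite ltr_pM2l].
by apply: ler_pM => //; exact: ltW.
Qed.

(* The principal branch, meaningful only on the half-plane Re z > 0. *)
Definition clog z : R[i] := Complex (ln (cmod z)) (atan (complex.Im z / complex.Re z)).

Lemma cexp_clog z : 0 < complex.Re z -> cexp (clog z) = z.
Proof.
move=> z0; have z1 : 0 < cmod z.
  by rewrite cmod_gt0; apply: contraTneq z0 => ->; rewrite ltxx.
rewrite /cexp /clog /= lnK ?posrE//.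
set t := complex.Im z / complex.Re z.
have c0 : cos (atan t) = complex.Re z / cmod z.
  rewrite cos_atan; have -> : 1 + t ^+ 2 = (cmod z / complex.Re z) ^+ 2.
    by rewrite [RHS]expr_div_n (sqr_cmod z) /t; field; rewrite gt_eqF.
  by rewrite sqrtr_sqr ger0_norm ?invf_div// divr_ge0 ?cmod_ge0// ltW.
have s0 : sin (atan t) = complex.Im z / cmod z.
  have : tan (atan t) = t by rewrite atanK.
  rewrite /tan => /(canRL (divfK _)) ->; first by rewrite c0 /t; field; rewrite !gt_eqF.
  by rewrite c0 mulf_neq0 ?invr_eq0 ?gt_eqF.
rewrite c0 s0; apply/eqP; rewrite eq_complex /=.
by apply/andP; split; apply/eqP; field; rewrite gt_eqF.
Qed.

Lemma ccont_clog z : 0 < complex.Re z -> ccont clog z.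
Proof.
move=> z0; have z1 : 0 < cmod z.
  by rewrite cmod_gt0; apply: contraTneq z0 => ->; rewrite ltxx.
apply: ccont_ReIm.
  by apply: ccontR_comp; [exact: ccontR_cmod|exact: continuous_ln].
apply: (@ccontR_comp (fun w => complex.Im w / complex.Re w)); last exact: continuous_atan.
apply: ccontRM; first exact: ccontR_Im.
apply: (@ccontR_comp (fun w => complex.Re w)); first exact: ccontR_Re.
by apply: inv_continuous; rewrite gt_eqF.
Qed.

Definition croot (m : nat) z := cexp ((m%:R^-1)%:C * clog z).

Lemma cexp_mulrn z n : cexp (z *+ n) = cexp z ^+ n.
Proof.
elim: n => [|n IH]; last by rewrite mulrS cexpD IH exprS.
rewrite mulr0n expr0 /cexp expR0 /= cos0 sin0; apply/eqP; rewrite eq_complex /=.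
by apply/andP; split; apply/eqP; ring.
Qed.

Lemma crootX m z : (0 < m)%N -> 0 < complex.Re z -> croot m z ^+ m = z.
Proof.
move=> m0 z0; rewrite /croot -cexp_mulrn -mulrnAl -rmorphMn /= -[X in X%:C]mulr_natr mulVf.
  by rewrite mul1r cexp_clog.
by rewrite pnatr_eq0 -lt0n.
Qed.

Lemma croot_neq0 m z : croot m z != 0.
Proof. by rewrite -cmod_gt0 cmod_cexp expR_gt0. Qed.

Lemma ccont_croot m z : 0 < complex.Re z -> ccont (croot m) z.
Proof.
move=> z0; apply: (@ccont_comp clog (fun w => cexp ((m%:R^-1)%:C * w))).
  exact: ccont_clog.
apply: cdiff_ccont; apply: (@cdiff_comp _ (fun w => (m%:R^-1)%:C * w)).
  by apply: cdiffM; [exact: cdiff_cst|exact: cdiff_id].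
exact: cdiff_cexp.
Qed.

(* w - z = (root w - root z) * S (root w) with S (root z) = m (root z)^(m-1) nonzero, so the
   continuity of the root gives its derivative. *)
Lemma cdiff_croot m z : (0 < m)%N -> 0 < complex.Re z -> cdiff (croot m) z.
Proof.
move=> m0 z0; set g := croot m.
(* The cofactor of y - g z in the factorisation of y^m - (g z)^m. *)
pose S (y : R[i]) := \sum_(i < m) y ^+ (m.-1 - i) * g z ^+ i.
have dS y : cdiff S y.
  apply: cdiff_sum => i; apply: cdiffM; last exact: cdiff_cst.
  by apply: cdiffX; exact: cdiff_id.
have Sz : S (g z) != 0.
  rewrite /S (eq_bigr (fun=> g z ^+ m.-1)); last first.
    by move=> i _; rewrite -exprD subnK// -ltnS prednK.
  rewrite sumr_const card_ord -mulr_natr mulf_neq0 ?expf_neq0 ?croot_neq0//.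
  by rewrite pnatr_eq0 -lt0n.
have hc : ccont (fun w => (S (g w))^-1) z.
  apply: (@ccont_comp g (fun y => (S y)^-1)); first exact: ccont_croot.
  by apply: cdiff_ccont; apply: cdiffV.
have hn : ccont (fun w => S (g w)) z.
  by apply: (@ccont_comp g S); [exact: ccont_croot|exact: cdiff_ccont].
apply/cdiffP; exists (S (g z))^-1 => e e0.
have Sz0 : 0 < cmod (S (g z)) by rewrite cmod_gt0.
have [d1 d10 hd1] := hc _ e0; have [d2 d20 hd2] := hn _ Sz0.
have [d3 d30 hd3] := @ccontR_Re z _ z0.
exists (Num.min (Num.min d1 d2) d3); first by rewrite !lt_min d10 d20.
move=> h; rewrite !lt_min => /andP[/andP[h1 h2] h3].
have e3 : z + h - z = h by rewrite addrC addKr.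
have := hd1 (z + h); rewrite e3 => /(_ h1) k1.
have := hd2 (z + h); rewrite e3 => /(_ h2) k2.
have := hd3 (z + h); rewrite e3 => /(_ h3) k3.
have Re0 : 0 < complex.Re (z + h) by move: k3; rewrite ltr_norml; lra.
have Sh : S (g (z + h)) != 0.
  apply: contraTneq k2 => ->; rewrite sub0r cmodN -leNgt.
  exact: lexx.
have := subrXX (g (z + h)) (g z) m; rewrite !crootX// e3 -/(S (g (z + h))) => e4.
have -> : g (z + h) - g z = h / S (g (z + h)).
  by apply: (canRL (mulfK Sh)); exact: (esym e4).
rewrite [_^-1 * h]mulrC -mulrBr cmodM mulrC ler_wpM2r ?cmod_ge0//.
exact: ltW.
Qed.

End ComplexRoot.

(** * The Fejer functional *)

Section Fejer.
Context (R : realType).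
Implicit Types (z w : R[i]) (s r : R) (F G : R[i] -> R[i]).

Lemma cmean_conj s F : ccirc s F -> cmean s (fun w => ((F w)^*)%C) = ((cmean s F)^*)%C.
Proof.
move=> hF; rewrite /cmean rmorphM; congr (_ * _); first exact/esym/conjc_real.
apply/eqP; rewrite eq_complex /=; apply/andP; split; apply/eqP.
  by apply: eq_Ri => t _; case: (F _).
rewrite -RiN; last exact: (ctnC_Im hF).
by apply: eq_Ri => t _; case: (F _).
Qed.

Lemma mulcJ_circ s w : cmod w = s -> (w^*)%C * w = (s ^+ 2)%:C.
Proof. by move=> we; rewrite mulrC mulcJ we. Qed.

Lemma ccirc_conjX s (b : nat) : ccirc s (fun w => ((w^*)%C) ^+ b).
Proof.
elim: b => [|b IH] t ht; first exact: ctn_cst.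
under [X in ctn X]funext do rewrite exprS.
apply: (@ctnM _ (fun t => ((circ s t)^*)%C) (fun t => ((circ s t)^*)%C ^+ b)); last exact: IH.
move=> e e0; have [d d0 hd] := @ctn_circ _ s t e e0; exists d => // t' /hd.
by rewrite -rmorphB cmodJ.
Qed.

Lemma cmean_powers_le s (a b : nat) : 0 <= s -> (b <= a)%N ->
  cmean s (fun w => w ^+ a * ((w^*)%C) ^+ b) = (s ^+ (2 * b))%:C *+ (a == b).
Proof.
move=> s0 ba.
rewrite (@eq_cmean _ _ _ (fun w => (s ^+ (2 * b))%:C * w ^+ (a - b)))//; last first.
  move=> w we; rewrite -{1}(subnK ba) exprD -mulrA -exprMn [w * _]mulrC (mulcJ_circ we).
  by rewrite -rmorphXn -exprM mulrC.
have c : ccirc s (fun w => w ^+ (a - b)).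
  by apply: (cdiff_circ s0) => w _; apply: cdiffX; exact: cdiff_id.
rewrite (cmeanZ _ c) (@mean_value _ _ (s + 1)); last 2 first.
- by apply/andP; split; lra.
- by move=> w _; apply: cdiffX; exact: cdiff_id.
by rewrite expr0n subn_eq0 eqn_leq ba andbT; case: (a <= b)%N; rewrite ?mulr1 ?mulr0.
Qed.

(** For b <= a the integrand is a constant times w^(a - b) on the circle, and the mean value
    property applies; conjugation exchanges the exponents. *)
Lemma cmean_powers s (a b : nat) : 0 <= s ->
  cmean s (fun w => w ^+ a * ((w^*)%C) ^+ b) = (s ^+ (2 * b))%:C *+ (a == b).
Proof.
move=> s0; have [ba|ab] := leqP b a; first exact: cmean_powers_le.
rewrite (ltn_eqF ab) mulr0n.
have c : ccirc s (fun w => w ^+ b * ((w^*)%C) ^+ a).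
  apply: (@ccircM _ _ (fun w => w ^+ b) (fun w => ((w^*)%C) ^+ a)).
    by apply: (cdiff_circ s0) => w _; apply: cdiffX; exact: cdiff_id.
  exact: ccirc_conjX.
have := cmean_conj c; rewrite (cmean_powers_le s0 (ltnW ab)) (gtn_eqF ab) mulr0n conjc0 => <-.
by apply: (eq_cmean s0) => w _; rewrite rmorphM !rmorphXn /= conjcK mulrC.
Qed.

(** Rescaled powers are unimodular on |w| = rho, hence orthonormal there, just like characters on
    the unit circle. *)
Local Notation e_ rho j w := ((w / rho%:C) ^+ j).

Lemma ccirc_unit_power rho (j : nat) s : 0 <= s -> ccirc s (fun w => e_ rho j w).
Proof.
move=> s0; apply: (cdiff_circ s0) => w _; apply: cdiffX; apply: cdiffM; first exact: cdiff_id.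
exact: cdiff_cst.
Qed.

Lemma ccirc_conj s F : ccirc s F -> ccirc s (fun w => ((F w)^*)%C).
Proof.
move=> hF t ht e e0; have [d d0 hd] := hF t ht e e0; exists d => // t' /hd.
by rewrite -rmorphB cmodJ.
Qed.

Lemma cmean_unit_powers rho (a b : nat) : 0 < rho ->
  cmean rho (fun w => e_ rho a w * ((e_ rho b w)^*)%C) = (a == b)%:R.
Proof.
move=> rho0; have c : ccirc rho (fun w => w ^+ a * ((w^*)%C) ^+ b).
  apply: (@ccircM _ _ (fun w => w ^+ a) (fun w => ((w^*)%C) ^+ b)).
    by apply: (cdiff_circ (ltW rho0)) => w _; apply: cdiffX; exact: cdiff_id.
  exact: ccirc_conjX.
rewrite (@eq_cmean _ _ _ (fun w => (rho ^- (a + b))%:C * (w ^+ a * ((w^*)%C) ^+ b)) (ltW rho0)).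
  rewrite (cmeanZ _ c) (cmean_powers _ _ (ltW rho0)).
  have [->|] := eqVneq a b; last by rewrite mulr0n mulr0.
  rewrite mulr1n -rmorphM /= addnn -mul2n mulVf//.
  by rewrite expf_neq0// gt_eqF.
move=> w _; have cj : ((w / rho%:C)^*)%C = (w^*)%C / rho%:C.
  by rewrite rmorphM; congr (_ * _); rewrite fmorphV; congr (_^-1); exact: conjc_real.
have -> : (((w / rho%:C) ^+ b)^*)%C = ((w^*)%C / rho%:C) ^+ b by rewrite -cj rmorphXn.
have -> : (rho ^- (a + b))%:C = (rho%:C)^-1 ^+ a * (rho%:C)^-1 ^+ b :> R[i].
  by rewrite -exprD exprVn fmorphV; congr (_^-1); rewrite rmorphXn.
by rewrite !exprMn; ring.
Qed.

(** * Lower bound for a bounded interpolant, tested against the Fejer kernel *)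

Section FejerBound.
Context (n : nat) (r : R) (G k : R[i] -> R[i]) (C : R).
Context (n0 : (0 < n)%N) (r0 : 0 <= r) (r1 : r < 1).
Context (hG : forall z, cmod z < 1 -> cdiff G z) (hk : forall z, cmod z < 1 -> cdiff k z).
Context (GC : forall z, cmod z < 1 -> cmod (G z) <= C).
Context (Gk : forall z, cmod z < 1 ->
  (1 + r%:C * z) * (\sum_(i < n) z ^+ i) - G z = z ^+ n * k z).

(** On |w| = rho the square |D|^2 is n times the Fejer kernel of order n. *)
Let D rho w := \sum_(j < n) e_ rho j w.

Let cdiff_D rho z : cdiff (D rho) z.
Proof.
apply: cdiff_sum => j; apply: cdiffX; apply: cdiffM; first exact: cdiff_id.
exact: cdiff_cst.
Qed.

Let ccirc_D rho s : 0 <= s -> ccirc s (D rho).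
Proof. by move=> s0; apply: (cdiff_circ s0) => w _; exact: cdiff_D. Qed.

Let cmean_D rho (a : nat) : 0 < rho ->
  cmean rho (fun w => (e_ rho a w * D rho w) * ((D rho w)^*)%C) =
  \sum_(j < n) \sum_(i < n) (a + j == i)%N%:R.
Proof.
move=> rho0; have rho0' := ltW rho0.
rewrite (@eq_cmean _ _ _ (fun w => \sum_(j < n) \sum_(i < n)
    (e_ rho (a + j) w * ((e_ rho i w)^*)%C)) rho0').
  have c i j : ccirc rho (fun w => e_ rho (a + j) w * ((e_ rho i w)^*)%C).
    apply: (@ccircM _ _ (fun w => e_ rho (a + j) w) (fun w => ((e_ rho i w)^*)%C)).
      exact: ccirc_unit_power.
    by apply: (@ccirc_conj _ (fun w => e_ rho i w)); exact: ccirc_unit_power.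
  rewrite cmean_sum; last by move=> j; apply: ccirc_sum => i; exact: c.
  apply: eq_bigr => j _; rewrite cmean_sum; last by move=> i; exact: c.
  by apply: eq_bigr => i _; exact: cmean_unit_powers.
move=> w _; rewrite /D mulr_sumr mulr_suml; apply: eq_bigr => j _.
by rewrite rmorph_sum mulr_sumr; apply: eq_bigr => i _; rewrite exprD.
Qed.

(** The a-th Fourier coefficient of |D|^2. Truncated subtraction gives the correct value 0 for a >=
    n, and a = n does occur in [S]. *)
Let count_lt (a : nat) : \sum_(j < n) \sum_(i < n) (a + j == i)%N%:R = (n - a)%N%:R :> R[i].
Proof.
under eq_bigr => j _.
  rewrite (_ : \sum_(i < n) _ = (a + j < n)%N%:R).
    over.
  have [aj|aj] := ltnP (a + j) n; last first.
    by rewrite big1// => i _; rewrite gtn_eqF// (leq_trans (ltn_ord i)).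
  rewrite (bigD1 (Ordinal aj))//= eqxx big1 ?addr0// => i.
  by rewrite -val_eqE /= eq_sym => /negbTE ->.
rewrite -natr_sum; congr _%:R.
rewrite -(big_mkord xpredT (fun j => (a + j < n)%N : nat)).
elim: n a => [|m IH] a; first by rewrite big_geq.
rewrite big_nat_recl// addn0.
under eq_bigr do rewrite addnS ltnS.
rewrite IH ltnS; case: leqP => [am|ma]; first by rewrite subSn.
have /eqP -> : (m - a == 0)%N by rewrite subn_eq0 ltnW.
by apply/esym/eqP; rewrite subn_eq0.
Qed.

Let P w : R[i] := (1 + r%:C * w) * (\sum_(i < n) w ^+ i).

Let S rho : R := \sum_(i < n) rho ^+ i * (n - i)%N%:R + r * \sum_(i < n) rho ^+ i.+1 * (n - i.+1)%N%:R.

Let cmean_PK rho : 0 < rho -> cmean rho (fun w => P w * (D rho w * ((D rho w)^*)%C)) = (S rho)%:C.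
Proof.
move=> rho0; have rho0' := ltW rho0; have rhoC : rho%:C != 0 :> R[i].
  by rewrite eq_complex /= negb_and gt_eqF.
have c (a : nat) : ccirc rho (fun w => e_ rho a w * D rho w * ((D rho w)^*)%C).
  apply: (@ccircM _ _ (fun w => e_ rho a w * D rho w) (fun w => ((D rho w)^*)%C)).
    apply: (@ccircM _ _ (fun w => e_ rho a w) (D rho)); first exact: ccirc_unit_power.
    exact: ccirc_D.
  by apply: (@ccirc_conj _ (D rho)); exact: ccirc_D.
have cz (z : R[i]) (a : nat) : ccirc rho (fun w => z * (e_ rho a w * D rho w * ((D rho w)^*)%C)).
  by apply: ccircM => //; exact: ccirc_cst.
have eX (a : nat) w : w ^+ a = (rho ^+ a)%:C * e_ rho a w.
  by rewrite rmorphXn /= -exprMn mulrC divfK.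
rewrite (@eq_cmean _ _ _ (fun w =>
    \sum_(i < n) (rho ^+ i)%:C * (e_ rho i w * D rho w * ((D rho w)^*)%C) +
    r%:C * \sum_(i < n) (rho ^+ i.+1)%:C * (e_ rho i.+1 w * D rho w * ((D rho w)^*)%C)) rho0').
  have c1 : ccirc rho (fun w => \sum_(i < n) (rho ^+ i)%:C *
      (e_ rho i w * D rho w * ((D rho w)^*)%C)) by apply: ccirc_sum.
  have c2 : ccirc rho (fun w => \sum_(i < n) (rho ^+ i.+1)%:C *
      (e_ rho i.+1 w * D rho w * ((D rho w)^*)%C)) by apply: ccirc_sum.
  rewrite (cmeanD c1) ?(cmeanZ _ c2); last by apply: ccircM => //; exact: ccirc_cst.
  rewrite !cmean_sum// /S rmorphD rmorphM !rmorph_sum /=.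
  by congr (_ + _ * _); apply: eq_bigr => i _;
    rewrite cmeanZ// cmean_D// count_lt rmorphM rmorph_nat.
move=> w _; rewrite /P mulrDl mul1r mulrDl; congr (_ + _).
  by rewrite mulr_suml; apply: eq_bigr => i _; rewrite eX -!mulrA.
rewrite -!mulrA; congr (_ * _); rewrite mulr_suml mulr_sumr; apply: eq_bigr => i _.
by rewrite mulrA -exprS eX -!mulrA.
Qed.

(** The kernel has degree below n: on the circle, w^n times the conjugate of D is a polynomial
    without constant term. The integrand thus agrees with a holomorphic function vanishing at 0. *)
Let cmean_remainder rho : 0 < rho < 1 ->
  cmean rho (fun w => (w ^+ n * k w) * (D rho w * ((D rho w)^*)%C)) = 0.
Proof.
move=> /andP[rho0 rho1]; have rho0' := ltW rho0; have rhoC : rho%:C != 0 :> R[i].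
  by rewrite eq_complex /= negb_and gt_eqF.
pose Q w : R[i] := \sum_(j < n) (rho ^+ j)%:C * w ^+ (n - j).
rewrite (@eq_cmean _ _ _ (fun w => k w * (D rho w * Q w)) rho0').
  rewrite (@mean_value _ _ 1); last 2 first.
  - by rewrite rho0' rho1.
  - move=> w w1; apply: cdiffM; first exact: hk.
    apply: cdiffM; first exact: cdiff_D.
    by apply: cdiff_sum => j; apply: cdiffM; [exact: cdiff_cst|apply: cdiffX; exact: cdiff_id].
  rewrite /Q big1 ?mulr0// => j _.
  by rewrite expr0n subn_eq0 leqNgt ltn_ord mulr0.
move=> w we; have -> : Q w = w ^+ n * ((D rho w)^*)%C; last by ring.
have -> : ((D rho w)^*)%C = \sum_(j < n) (((w / rho%:C) ^+ j)^*)%C by rewrite rmorph_sum.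
rewrite mulr_sumr; apply: eq_bigr => j _.
have cj : ((w / rho%:C)^*)%C = (w^*)%C / rho%:C.
  by rewrite rmorphM; congr (_ * _); rewrite fmorphV; congr (_^-1); exact: conjc_real.
have -> : (((w / rho%:C) ^+ j)^*)%C = ((w^*)%C / rho%:C) ^+ j by rewrite -cj rmorphXn.
have -> : w ^+ n = w ^+ (n - j) * w ^+ j by rewrite -exprD subnK// ltnW.
rewrite -mulrA [LHS]mulrC; congr (_ * _).
rewrite -exprMn mulrA [w * _]mulrC (mulcJ_circ we) rmorphXn; congr (_ ^+ _).
by rewrite expr2 rmorphM /= mulfK.
Qed.

Let fejer_bound_radius rho : 0 < rho < 1 -> S rho <= C * n%:R.
Proof.
move=> rho01; have /andP[rho0 rho1] := rho01; have rho0' := ltW rho0.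
have cD : ccirc rho (D rho) by exact: ccirc_D.
have cK : ccirc rho (fun w => D rho w * ((D rho w)^*)%C).
  by apply: (@ccircM _ _ (D rho) (fun w => ((D rho w)^*)%C)) => //; exact: ccirc_conj.
have cG : ccirc rho G by apply: (cdiff_circ rho0') => w we; apply: hG; rewrite we.
have ck : ccirc rho (fun w => w ^+ n * k w).
  apply: (cdiff_circ rho0') => w we; apply: cdiffM; last by apply: hk; rewrite we.
  by apply: cdiffX; exact: cdiff_id.
have e1 : (S rho)%:C = cmean rho (fun w => G w * (D rho w * ((D rho w)^*)%C)).
  rewrite -(cmean_PK rho0) -[RHS]addr0 -(cmean_remainder rho01) -cmeanD.
  - apply: (eq_cmean rho0') => w we; rewrite -Gk ?we//.
    by rewrite -/(P w) -mulrDl addrC subrK.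
  - exact: ccircM.
  - exact: (ccircM ck cK).
have cGK := ccircM cG cK.
have := cmod_cmean cGK; rewrite -e1 cmod_real => h1.
apply: (le_trans (ler_norm _)); apply: (le_trans h1).
have cD2 : rcirc rho (fun w => cmod (D rho w) ^+ 2).
  by apply: rcircM; exact: rcirc_cmod.
have -> : n%:R = rmean rho (fun w => cmod (D rho w) ^+ 2).
  apply: complexI; rewrite -cmean_real rmorph_nat.
  have := cmean_D 0 rho0; rewrite count_lt subn0 => <-.
  by apply: (eq_cmean rho0') => w _; rewrite expr0 mul1r mulcJ.
rewrite -(rmeanZ _ cD2); apply: (le_rmean rho0').
- exact: rcirc_cmod.
- by apply: rcircM => //; exact: rcirc_cst.
move=> w we; rewrite !cmodM cmodJ -expr2 ler_wpM2r ?sqr_ge0// GC// we.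
exact: rho1.
Qed.

Let sum_down (m : nat) : 2 * \sum_(i < m) (m - i)%N%:R = m%:R * (m%:R + 1) :> R.
Proof.
elim: m => [|m IH]; first by rewrite big_ord0 mulr0 mul0r.
rewrite big_ord_recl subn0 mulrDr.
under eq_bigr do rewrite lift0 subSS.
by rewrite IH -natr1; ring.
Qed.

(** All powers of rho are replaced by rho^n. The sums are then n(n + 1)/2 and n(n - 1)/2, and the
    surplus n(1 - r)/2 is dropped. *)
Let S_lower rho : 0 < rho < 1 -> rho ^+ n * (n%:R ^+ 2 * (1 + r) / 2) <= S rho.
Proof.
move=> /andP[rho0 rho1].
have h (a : nat) : (a <= n)%N -> rho ^+ n <= rho ^+ a.
  by move=> an; apply: ler_wiXn2l => //; exact: ltW.
have h1 : rho ^+ n * \sum_(i < n) (n - i)%N%:R <= \sum_(i < n) rho ^+ i * (n - i)%N%:R.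
  by rewrite mulr_sumr; apply: ler_sum => i _; rewrite ler_wpM2r// h// ltnW.
have h2 : rho ^+ n * \sum_(i < n) (n - i.+1)%N%:R <=
    \sum_(i < n) rho ^+ i.+1 * (n - i.+1)%N%:R.
  by rewrite mulr_sumr; apply: ler_sum => i _; rewrite ler_wpM2r// h.
have s1 := sum_down n.
have s2 : 2 * \sum_(i < n) (n - i.+1)%N%:R = n%:R * (n%:R - 1) :> R.
  move: n0; case: n => // m _; rewrite big_ord_recr /= subnn addr0.
  under eq_bigr do rewrite subSS.
  by rewrite sum_down -natr1; ring.
have rn : 0 < rho ^+ n by rewrite exprn_gt0.
have n1 : 1 <= n%:R :> R by rewrite ler1n.
rewrite /S; apply: (@le_trans _ _ (rho ^+ n * \sum_(i < n) (n - i)%N%:R +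
  r * (rho ^+ n * \sum_(i < n) (n - i.+1)%N%:R))); last by rewrite lerD// ler_wpM2l.
have -> : \sum_(i < n) (n - i)%N%:R = n%:R * (n%:R + 1) / 2 :> R by lra.
have -> : \sum_(i < n) (n - i.+1)%N%:R = n%:R * (n%:R - 1) / 2 :> R by lra.
have hnr : 0 <= n%:R * (1 - r) by rewrite mulr_ge0// subr_ge0 ltW.
by rewrite [r * _]mulrCA -mulrDr ler_wpM2l ?(ltW rn)//; lra.
Qed.

Lemma fejer_bound : n%:R * (1 + r) / 2 <= C.
Proof.
have n1 : 1 <= n%:R :> R by rewrite ler1n.
set X := n%:R * (1 + r) / 2; have nn : 0 < n%:R :> R by rewrite ltr0n.
have rr : 0 < 1 + r by rewrite ltr_pwDl.
have X0 : 0 < X by rewrite /X divr_gt0// mulr_gt0.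
have C0 : 0 <= C.
  by apply: le_trans (cmod_ge0 (G 0)) _; apply: GC; rewrite cmod0.
rewrite leNgt; apply/negP => CX.
(* Instead of letting rho tend to 1, one radius with rho^n = t strictly between C/X and 1 is enough:
   it would give tX <= C. *)
pose t := (C / X + 1) / 2.
have CX1 : C / X < 1 by rewrite ltr_pdivrMr// mul1r.
have CX0 : 0 <= C / X by rewrite divr_ge0// ltW.
have t01 : 0 < t < 1 by rewrite /t; lra.
have /andP[t0 t1] := t01.
pose rho := t `^ n%:R^-1.
have rho0 : 0 < rho by rewrite powR_gt0.
have rhon : rho ^+ n = t.
  rewrite -(powR_mulrn _ (ltW rho0)) -powRrM mulVf ?powRr1 ?ltW//.
  by rewrite pnatr_eq0 -lt0n.
have rho1 : rho < 1.
  rewrite ltNge; apply/negP => h; have := exprn_ege1 n h; rewrite rhon; lra.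
have rho01 : 0 < rho < 1 by rewrite rho0.
have := le_trans (S_lower rho01) (fejer_bound_radius rho01).
rewrite rhon (_ : n%:R ^+ 2 * (1 + r) / 2 = n%:R * X); last by rewrite /X; field.
rewrite [C * _]mulrC mulrCA ler_pM2l; last by lra.
rewrite /t => h; have : C / X * X = C by rewrite divfK// gt_eqF.
by move=> e; nra.
Qed.

End FejerBound.

End Fejer.

(** * The extremal function *)

Section ExtremalFunction.
Context (R : realType) (n m : nat) (r : R).
Context (n0 : (0 < n)%N) (m0 : (0 < m)%N) (r0 : 0 <= r) (r1 : r < 1).
Implicit Types (z w : R[i]) (s : R).

Let l : R[i] := - r%:C.
Let b z := blaschke_factor l z.

Let cl : cmod l = r.
Proof. by rewrite cmodN cmod_real ger0_norm. Qed.

Let l1 : cmod l < 1.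
Proof. by rewrite cl. Qed.

Let lJ : (l^*)%C = l.
Proof. by rewrite rmorphN; congr (- _); exact: conjc_real. Qed.

Let bE z : b z = - (r%:C + z) / (1 + r%:C * z).
Proof.
rewrite /b /blaschke_factor lJ.
by rewrite mulNr opprK opprD.
Qed.

Let den_neq0 z : cmod z < 1 -> 1 + r%:C * z != 0.
Proof.
move=> z1; have := blaschke_den_neq0 l1 z1; rewrite lJ.
by rewrite mulNr opprK.
Qed.

Let Re_gt0 z : cmod z < 1 -> 0 < complex.Re (1 + z).
Proof. by move=> z1; rewrite ReD /=; have := Re_le_cmod z; rewrite ler_norml; lra. Qed.

Let neq0_Re z : 0 < complex.Re z -> z != 0.
Proof. by apply: contraTneq => ->; rewrite ltxx. Qed.

Let b_lt1 z : cmod z < 1 -> cmod (b z) < 1.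
Proof. exact: blaschke_factor_lt1. Qed.

Let bX_lt1 z : cmod z < 1 -> cmod (- b z ^+ n) < 1.
Proof. by move=> z1; rewrite cmodN cmodX exprn_ilt1 ?cmod_ge0 ?b_lt1// -lt0n. Qed.

Let Re_bX z : cmod z < 1 -> 0 < complex.Re (1 - b z ^+ n).
Proof. by move=> z1; apply: Re_gt0; exact: bX_lt1. Qed.

(** Since b(-1) = 1, the numerator vanishes together with the denominator; the function peaks at -1
    with height N = n(1 + r)/(1 - r). *)
Definition extremal_pow z : R[i] := (1 - b z ^+ n) / (1 + z).

(** A quotient of roots, not a root of the quotient: numerator and denominator have positive real
    part in the disc, but their quotient need not. *)
Definition extremal z : R[i] := croot m (1 - b z ^+ n) / croot m (1 + z).

Lemma extremalX z : cmod z < 1 -> extremal z ^+ m = extremal_pow z.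
Proof.
by move=> z1; rewrite expr_div_n !crootX//; [exact: Re_gt0|exact: Re_bX].
Qed.

Let cdiff_b z : cmod z < 1 -> cdiff b z.
Proof. exact: cdiff_blaschke_factor. Qed.

Lemma cdiff_extremal z : cmod z < 1 -> cdiff extremal z.
Proof.
move=> z1; apply: cdiffM.
  apply: (@cdiff_comp _ (fun w => 1 - b w ^+ n)).
    apply: cdiffB; first exact: cdiff_cst.
    by apply: cdiffX; exact: cdiff_b.
  by apply: cdiff_croot => //; exact: Re_bX.
apply: cdiffV; first exact: croot_neq0.
apply: (@cdiff_comp _ (fun w => 1 + w)).
  by apply: cdiffD; [exact: cdiff_cst|exact: cdiff_id].
by apply: cdiff_croot => //; exact: Re_gt0.
Qed.

Let b_invol z : cmod z < 1 -> b (b z) = z.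
Proof.
have r0' := r0; have r1' := r1.
move=> z1; have d0 := den_neq0 z1; have d1 := den_neq0 (b_lt1 z1).
move: d1; rewrite !bE => d1.
rewrite -[LHS](mulfK d0) -[RHS](mulfK d0); congr (_ / _).
have h : (1 - r%:C * r%:C) != 0 :> R[i].
  rewrite subr_eq0; apply: cmod_neq; rewrite cmod1 cmodM cmod_real gt_eqF//.
  by rewrite ger0_norm//; nra.
have e : 1 + r%:C * (- (r%:C + z) / (1 + r%:C * z)) = (1 - r%:C * r%:C) / (1 + r%:C * z).
  by field.
by rewrite e; field; rewrite d0 h.
Qed.

Let extremal_pow_b z : cmod z < 1 ->
  (1 - r)%:C * extremal_pow (b z) = (1 + r%:C * z) * (\sum_(i < n) z ^+ i).
Proof.
move=> z1; rewrite /extremal_pow b_invol//.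
have d0 := den_neq0 z1.
have z10 : 1 - z != 0 by apply: neq0_Re; apply: Re_gt0; rewrite cmodN.
have rC : 1 - r%:C != 0 :> R[i].
  by rewrite subr_eq0; apply: cmod_neq; rewrite cmod1 cmod_real ger0_norm// gt_eqF.
have e : 1 + b z = (1 - r%:C) * (1 - z) / (1 + r%:C * z) by rewrite bE; field.
have -> : (1 - r)%:C = 1 - r%:C :> R[i] by rewrite rmorphB.
have := subrX1 z n => e2.
have -> : 1 - z ^+ n = (1 - z) * (\sum_(i < n) z ^+ i).
  by rewrite -[LHS]opprB e2; ring.
by rewrite e; field; rewrite z10 rC d0.
Qed.

Let N : R := n%:R * (1 + r) / (1 - r).

Let N_ge1 : 1 <= N.
Proof.
have r0' := r0; have r1' := r1.
have n1 : 1 <= n%:R :> R by rewrite ler1n.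
rewrite /N ler_pdivlMr ?subr_gt0//.
apply: (@le_trans _ _ (1 * (1 + r))); first by lra.
by rewrite ler_wpM2r//; lra.
Qed.

(** As b is an involution, composing with it turns divisibility by b^n into divisibility by z^n; the
    factor 1 - r then makes the function to be interpolated the polynomial of [fejer_bound]. *)
Lemma extremal_lower (g h : R[i] -> R[i]) (G : R) :
  (forall z, cmod z < 1 -> cdiff g z) -> (forall z, cmod z < 1 -> cdiff h z) ->
  (forall z, cmod z < 1 -> extremal z - g z = b z ^+ n * h z) ->
  (forall z, cmod z < 1 -> cmod (g z) <= G) -> N / 2 <= G ^+ m.
Proof.
have r0' := r0; have r1' := r1.
move=> dg dh gh gG.
pose k z := h z * \sum_(i < m) extremal z ^+ (m.-1 - i) * g z ^+ i.
have dk z : cmod z < 1 -> cdiff k z.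
  move=> z1; apply: cdiffM; first exact: dh.
  apply: cdiff_sum => i; apply: cdiffM; first by apply: cdiffX; exact: cdiff_extremal.
  by apply: cdiffX; exact: dg.
have kE z : cmod z < 1 -> extremal_pow z - g z ^+ m = b z ^+ n * k z.
  by move=> z1; rewrite -extremalX// subrXX gh// /k mulrA.
have comp f z : (forall z, cmod z < 1 -> cdiff f z) -> cmod z < 1 -> cdiff (fun w => f (b w)) z.
  by move=> df z1; apply: (cdiff_comp (cdiff_b z1)); apply: df; exact: b_lt1.
have r10 : 0 < 1 - r by lra.
have := @fejer_bound R n r (fun z => (1 - r)%:C * g (b z) ^+ m) (fun z => (1 - r)%:C * k (b z))
  ((1 - r) * G ^+ m) n0 r0 r1.
have h1 z : cmod z < 1 -> cdiff (fun z => (1 - r)%:C * g (b z) ^+ m) z.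
  by move=> z1; apply: cdiffM; [exact: cdiff_cst|apply: cdiffX; exact: comp].
have h2 z : cmod z < 1 -> cdiff (fun z => (1 - r)%:C * k (b z)) z.
  by move=> z1; apply: cdiffM; [exact: cdiff_cst|exact: comp].
have h3 z : cmod z < 1 -> cmod ((1 - r)%:C * g (b z) ^+ m) <= (1 - r) * G ^+ m.
  move=> z1; rewrite cmodM cmod_real ger0_norm ?(ltW r10)// ler_wpM2l ?(ltW r10)//.
  by rewrite cmodX lerXn2r ?nnegrE ?cmod_ge0 ?(le_trans (cmod_ge0 _) (gG _ (b_lt1 z1)))// gG// b_lt1.
have h4 z : cmod z < 1 -> (1 + r%:C * z) * (\sum_(i < n) z ^+ i) - (1 - r)%:C * g (b z) ^+ m =
    z ^+ n * ((1 - r)%:C * k (b z)).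
  move=> z1; rewrite -extremal_pow_b// -mulrBr kE ?b_lt1// b_invol//; ring.
move=> /(_ h1 h2 h3 h4) hh.
by rewrite /N mulrAC ler_pdivrMr// mulrC; move: hh; rewrite [n%:R * _ / 2]mulrAC; lra.
Qed.

(** The first bound is the decay away from -1. The second comes from the factorisation of the
    function as (1 + r)/(1 + rz) times a sum of n powers of b. *)
Let extremal_pow_bounds z : cmod z < 1 ->
  cmod (extremal_pow z) * cmod (1 + z) <= 2 /\ cmod (extremal_pow z) <= N.
Proof.
have r0' := r0; have r1' := r1.
move=> z1; have z10 : 1 + z != 0 by apply: neq0_Re; exact: Re_gt0.
have cz : 0 < cmod (1 + z) by rewrite cmod_gt0.
have r10 : 0 < 1 - r by lra.
have e : cmod (extremal_pow z) * cmod (1 + z) = cmod (1 - b z ^+ n).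
  by rewrite -cmodM /extremal_pow divfK.
split.
  rewrite e (le_trans (cmodD _ _))// cmod1.
  by have := bX_lt1 z1; lra.
rewrite -(ler_pM2r cz) e.
have -> : 1 - b z ^+ n = (1 - b z) * \sum_(i < n) b z ^+ i.
  by rewrite -[LHS]opprB subrX1; ring.
have d0 := den_neq0 z1; have cd : 0 < cmod (1 + r%:C * z) by rewrite cmod_gt0.
have -> : 1 - b z = (1 + r)%:C * (1 + z) / (1 + r%:C * z).
  by rewrite bE rmorphD rmorph1; field.
have s1 : cmod (\sum_(i < n) b z ^+ i) <= n%:R.
  rewrite -[n in n%:R]card_ord -sum1_card natr_sum.
  elim/big_ind2: _ => [|x1 y1 x2 y2 h1 h2|i _]; first by rewrite cmod0.
    by rewrite (le_trans (cmodD _ _))// lerD.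
  by rewrite cmodX exprn_ile1 ?cmod_ge0// ltW// b_lt1.
rewrite !cmodM cmodV cmod_real ger0_norm; last by lra.
have hd : 1 - r <= cmod (1 + r%:C * z).
  have := ler_cmodB 1 (- (r%:C * z)); rewrite opprK cmod1 cmodN cmodM cmod_real ger0_norm//.
  by have := cmod_ge0 z; nra.
rewrite (_ : N * cmod (1 + z) = (1 + r) * cmod (1 + z) / (1 - r) * n%:R); last first.
  by rewrite /N; field; rewrite gt_eqF.
apply: ler_pM => //; rewrite ?cmod_ge0 ?divr_ge0 ?mulr_ge0 ?cmod_ge0 ?addr_ge0//.
by rewrite ler_wpM2l ?mulr_ge0 ?cmod_ge0 ?addr_ge0// lef_pV2 ?posrE.
Qed.

(* Mean value of (1 - a w)/(1 + a w), whose real part is (1 - a^2 |w|^2)/|1 + a w|^2. *)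
Let rmean_inv_affine (a s : R) : 0 <= a < 1 -> 0 <= s < 1 ->
  rmean s (fun w => (cmod (1 + a%:C * w) ^+ 2)^-1) = (1 - a ^+ 2 * s ^+ 2)^-1.
Proof.
have r0' := r0; have r1' := r1.
move=> /andP[a0 a1] /andP[s0 s1].
have d0 w : cmod w < 1 -> 1 + a%:C * w != 0.
  move=> w1; apply: neq0_Re; apply: Re_gt0; rewrite cmodM cmod_real ger0_norm//.
  by have := cmod_ge0 w; nra.
have dd w : cmod w < 1 -> cdiff (fun w => 1 + a%:C * w) w.
  move=> w1; apply: cdiffD; first exact: cdiff_cst.
  by apply: cdiffM; [exact: cdiff_cst|exact: cdiff_id].
have k0 : 1 - a ^+ 2 * s ^+ 2 != 0.
  by rewrite -exprMn gt_eqF// subr_gt0 exprn_ilt1 ?mulr_ge0//; nra.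
have c : rcirc s (fun w => (cmod (1 + a%:C * w) ^+ 2)^-1).
  have c1 : rcirc s (fun w => cmod (1 + a%:C * w)).
    by apply: rcirc_cmod; apply: (cdiff_circ s0) => w we; apply: dd; rewrite we.
  apply: rcirc_inv => //; first exact: (rcircM c1 c1).
  by move=> w we; rewrite expf_neq0// cmod_eq0 d0// we.
pose F w := (1 - a%:C * w) / (1 + a%:C * w).
have dF w : cmod w < 1 -> cdiff F w.
  move=> w1; apply: cdiffM.
    apply: cdiffB; first exact: cdiff_cst.
    by apply: cdiffM; [exact: cdiff_cst|exact: cdiff_id].
  by apply: cdiffV; [exact: d0|exact: dd].
have F0 : cmean s F = 1.
  by rewrite (@mean_value _ _ 1) ?s0// /F mulr0 subr0 addr0 divr1.
have : complex.Re (cmean s F) = rmean s (fun w => complex.Re (F w)) by rewrite ReZ.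
rewrite F0 /= => e.
have h : (1 - a ^+ 2 * s ^+ 2) * rmean s (fun w => (cmod (1 + a%:C * w) ^+ 2)^-1) = 1.
  rewrite -(rmeanZ _ c) [RHS]e; apply: eq_rmean => // w we.
  have w1 : cmod w < 1 by rewrite we.
  have D0 : (cmod (1 + a%:C * w) ^+ 2) != 0 by rewrite expf_neq0// cmod_eq0 d0.
  have eF : F w = ((cmod (1 + a%:C * w) ^+ 2)^-1)%:C *
      ((1 - a%:C * w) * ((1 + a%:C * w)^*)%C).
    have -> : ((cmod (1 + a%:C * w) ^+ 2)^-1)%:C =
        ((1 + a%:C * w) * ((1 + a%:C * w)^*)%C)^-1 by rewrite mulcJ fmorphV.
    rewrite /F; have J0 : ((1 + a%:C * w)^*)%C != 0 by rewrite conjc_eq0 d0.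
    have gen (x y z : R[i]) : y != 0 -> z != 0 -> x / y = (y * z)^-1 * (x * z).
      by move=> y0 z0; field; rewrite y0 z0.
    by apply: gen => //; exact: d0.
  rewrite eF ReZ mulrC; congr (_ * _); rewrite -we sqr_cmod.
  by case: (w) => x y /=; ring.
by apply: (mulfI k0); rewrite h divff.
Qed.

(** Both pointwise bounds are merged into the single majorant (8/3)/|1 + a w|, whose quadratic mean
    [rmean_inv_affine] evaluates exactly. *)
Lemma rmean_extremal_pow s : 0 <= s < 1 ->
  rmean s (fun w => cmod (extremal_pow w) ^+ 2) <= 8 * N.
Proof.
have r0' := r0; have r1' := r1.
move=> s01; have /andP[s0 s1] := s01.
(* with 1 - a = 2/(3 N) the two bounds above give |f| |1 + a w| <= 2 + 2/3 *)
pose a := 1 - 2 / (3 * N).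
have N1 := N_ge1; have N0 : 0 < N by lra.
have aN : (1 - a) * N = 2 / 3 by rewrite /a; field; rewrite gt_eqF.
have a1 : a < 1 by rewrite /a ltrBlDr ltrDl divr_gt0// mulr_gt0.
have a0 : 0 <= a by nra.
have a01 : 0 <= a < 1 by rewrite a0.
have d0 w : cmod w < 1 -> 1 + a%:C * w != 0.
  move=> w1; apply: neq0_Re; apply: Re_gt0; rewrite cmodM cmod_real ger0_norm//.
  by have := cmod_ge0 w; nra.
have cE : ccirc s extremal_pow.
  apply: (cdiff_circ s0) => w we; have w1 : cmod w < 1 by rewrite we.
  apply: cdiffM.
    apply: cdiffB; first exact: cdiff_cst.
    by apply: cdiffX; exact: cdiff_b.
  apply: cdiffV; first by apply: neq0_Re; exact: Re_gt0.
  by apply: cdiffD; [exact: cdiff_cst|exact: cdiff_id].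
have c1 := rcirc_cmod cE.
have c : rcirc s (fun w => (cmod (1 + a%:C * w) ^+ 2)^-1).
  have c2 : rcirc s (fun w => cmod (1 + a%:C * w)).
    apply: rcirc_cmod; apply: ccircD; first exact: ccirc_cst.
    by apply: ccircM; [exact: ccirc_cst|exact: ccirc_id].
  apply: rcirc_inv => //; first exact: (rcircM c2 c2).
  by move=> w we; rewrite expf_neq0// cmod_eq0 d0// we.
apply: (@le_trans _ _ (rmean s (fun w => 64 / 9 * (cmod (1 + a%:C * w) ^+ 2)^-1))).
  apply: (le_rmean s0); first exact: (rcircM c1 c1).
    by apply: rcircM => //; exact: rcirc_cst.
  move=> w we; have w1 : cmod w < 1 by rewrite we.
  have D0 : 0 < cmod (1 + a%:C * w) by rewrite cmod_gt0 d0.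
  rewrite ler_pdivlMr ?exprn_gt0// -exprMn.
  have [e1 e2] := extremal_pow_bounds w1.
  have x0 := cmod_ge0 (extremal_pow w).
  have h : cmod (1 + a%:C * w) <= cmod (1 + w) + (1 - a).
    have := cmodB (1 + w) ((1 - a)%:C * w).
    rewrite (_ : 1 + w - _ = 1 + a%:C * w); last by rewrite rmorphB rmorph1; ring.
    rewrite [cmod (_ * w)]cmodM cmod_real ger0_norm; last by lra.
    by move=> h; have := cmod_ge0 w; nra.
  have h2 : cmod (extremal_pow w) * cmod (1 + a%:C * w) <= 8 / 3.
    by have := ler_wpM2l x0 h; nra.
  have -> : 64 / 9 = (8 / 3) ^+ 2 :> R by field.
  by rewrite ler_pXn2r// nnegrE ?divr_ge0// mulr_ge0// cmod_ge0.
rewrite (rmeanZ _ c) rmean_inv_affine//.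
(* Here 1 - a^2 = (12N - 4)/(9N^2), so (64/9)/(1 - a^2) = 16N^2/(3N - 1), which is at most 8N
   exactly because N >= 1. *)
have k1 : 1 - a ^+ 2 <= 1 - a ^+ 2 * s ^+ 2.
  by rewrite lerD2l lerN2 ler_piMr ?sqr_ge0// expr_le1// ltW.
have k2 : (1 - a ^+ 2) * (9 * N ^+ 2) = 12 * N - 4.
  by rewrite (_ : _ * _ = 9 * ((1 - a) * N) * (2 * N - (1 - a) * N)); [rewrite aN; field|ring].
have k0 : 0 < 1 - a ^+ 2 by nra.
rewrite ler_pdivrMr; last by lra.
apply: (@le_trans _ _ (8 * N * (1 - a ^+ 2))); last by rewrite ler_pM2l// mulr_gt0.
by have : 64 * N <= 8 * ((1 - a ^+ 2) * (9 * N ^+ 2)); [rewrite k2; lra|nra].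
Qed.

End ExtremalFunction.

(** * Assembly of the lower bound *)

Section LowerBound.
Context (R : realType).

Lemma blaschke_nseq n (l z : R[i]) : blaschke (nseq n l) z = blaschke_factor l z ^+ n.
Proof.
rewrite /blaschke; elim: n => [|n IH]; first by rewrite big_nil.
by rewrite big_cons IH exprS.
Qed.

Lemma Cnr_lower (p n : nat) (r : R) : (0 < p)%N -> ~~ odd p -> (1 <= n)%N -> 0 <= r < 1 ->
  (((32 `^ (p%:R^-1))^-1 * (n%:R / (1 - r)) `^ (p%:R^-1))%:E
     <= Cnr n r (Hardy p%:R%:E) (Hardy +oo))%E.
Proof.
move=> p0 po n1 /andP[r0 r1].
pose m := p./2; have pm : p = (m * 2)%N by rewrite muln2 -[LHS]odd_double_half (negbTE po).
have m0 : (0 < m)%N by move: p0; rewrite pm muln_gt0 => /andP[].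
have q0 : 0 < p%:R :> R by rewrite ltr0n.
pose N : R := n%:R * (1 + r) / (1 - r).
have n0 : 0 < n%:R :> R by rewrite ltr0n.
have r10 : 0 < 1 - r by lra.
have N0 : 0 < N by rewrite divr_gt0// mulr_gt0//; lra.
have N8 : 0 < 8 * N by rewrite mulr_gt0.
(* The normalising factor: the p-th mean of the extremal function is at most 8N. *)
pose c : R := ((8 * N) `^ p%:R^-1)^-1.
have c0 : 0 < c by rewrite invr_gt0 powR_gt0.
have rootX (x : R) : 0 <= x -> (x `^ p%:R^-1) ^+ p = x.
  move=> x0; rewrite -powR_mulrn ?powR_ge0// -powRrM mulVf ?powRr1//.
  by rewrite gt_eqF.
have cp : c ^+ p = (8 * N)^-1 by rewrite exprVn rootX// ltW.
pose f (z : R[i]) := c%:C * extremal n m r z.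
have df z : cmod z < 1 -> cdiff f z.
  by move=> z1; apply: cdiffM; [exact: cdiff_cst|exact: cdiff_extremal].
have hf : Hol f by exact: df.
have f1 : (hardy_norm p%:R%:E f <= 1)%E.
  apply/(hardy_norm_le1 q0 hf) => s s01; have /andP[s0 s1] := s01.
  have := rmean_extremal_pow (n := n) n1 r0 r1 s01 => hE.
  have cE : rcirc s (fun w => cmod (extremal n m r w) ^+ m ^+ 2).
    have ce : ccirc s (extremal n m r).
      by apply: (cdiff_circ s0) => w we; apply: cdiff_extremal; rewrite ?we.
    have ce2 : ccirc s (fun w => extremal n m r w ^+ m ^+ 2).
      apply: (cdiff_circ s0) => w we; do 2 apply: cdiffX.
      by apply: cdiff_extremal; rewrite ?we.
    move=> t ht; have := rcirc_cmod ce2 ht.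
    by under [X in {for _, continuous X}]funext do rewrite !cmodX.
  rewrite (@eq_rmean _ _ _ (fun w => (8 * N)^-1 * (cmod (extremal n m r w) ^+ m ^+ 2)) s0).
    rewrite (rmeanZ _ cE) (@eq_rmean _ _ _ (fun w => cmod (extremal_pow n r w) ^+ 2) s0).
      by rewrite ler_pdivrMl// mulr1.
    by move=> w we; rewrite -(@extremalX _ n m r)// ?we// cmodX.
  move=> w _; rewrite powR_mulrn ?cmod_ge0// /f cmodM cmod_real gtr0_norm// exprMn cp.
  by rewrite -exprM -pm.
have fX : carrier (Hardy (p%:R%:E : \bar R)) f.
  by split => //; apply: le_lt_trans f1 (ltry _).
pose sigma := nseq n (- r%:C : R[i]).
apply: (@le_trans _ _ (interp_const sigma (Hardy p%:R%:E) (Hardy +oo))); last first.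
  apply: ereal_sup_ubound; exists sigma => //; split; first by rewrite size_nseq.
  by move=> l /nseqP[-> _]; rewrite cmodN cmod_real ger0_norm.
apply: (@le_trans _ _ (ereal_inf [set hardy_norm +oo g | g in
    [set g | carrier (Hardy (+oo : \bar R)) g /\ agree_on sigma g f]])); last first.
  by apply: ereal_sup_ubound; exists f.
apply: le_ereal_inf_tmp => _ [g [[hg gb] [h hh fg]] <-].
(* Membership in the space excludes +oo, and the value of |g| at 0 excludes -oo. *)
have := gb; case E : (hardy_norm +oo g) => [G| |] // _; last first.
  have d0 : disc (0 : R[i]) by rewrite /disc /= cmod0.
  have : ((cmod (g 0))%:E <= hardy_norm +oo g :> \bar R)%E.
    by apply: ereal_sup_ubound; exists 0.
  by rewrite E.
have gG z : cmod z < 1 -> cmod (g z) <= G.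
  by move: z; apply/hardy_norm_inftyP; rewrite E.
rewrite lee_fin.
have G0 : 0 <= G by apply: le_trans (cmod_ge0 _) (gG 0 _); rewrite cmod0.
have cC : c%:C != 0 :> R[i] by rewrite eq_complex /= negb_and gt_eqF.
have ciC : cmod (c%:C^-1 : R[i]) = c^-1 by rewrite cmodV cmod_real gtr0_norm.
have hN : N / 2 <= (c^-1 * G) ^+ m.
  apply: (@extremal_lower _ n m r n1 m0 r0 r1 (fun z => c%:C^-1 * g z) (fun z => c%:C^-1 * h z)).
  - by move=> z z1; apply: cdiffM; [exact: cdiff_cst|exact: hg].
  - by move=> z z1; apply: cdiffM; [exact: cdiff_cst|exact: hh].
  - move=> z z1; have := fg z z1; rewrite blaschke_nseq /f => e.
    by rewrite mulrCA -e mulrBr mulKf.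
  - by move=> z z1; rewrite cmodM ciC; apply: ler_wpM2l; [rewrite invr_ge0 ltW|exact: gG].
(* Squaring [hN] gives N^2/4 <= 8N G^p, since c^(-p) = 8N and p = 2m. *)
have hG : N / 32 <= G ^+ p.
  have : (N / 2) ^+ 2 <= (c^-1 * G) ^+ p.
    rewrite [in leRHS]pm exprM ler_pXn2r ?nnegrE//; first by rewrite divr_ge0// ltW.
    by rewrite exprn_ge0// mulr_ge0// invr_ge0 ltW.
  rewrite [leRHS]exprMn [c^-1 ^+ p]exprVn cp invrK => h1.
  have : N * (N / 32) <= N * G ^+ p by lra.
  by rewrite ler_pM2l.
rewrite -(@ler_pXn2r _ p) ?nnegrE//; last first.
  by rewrite mulr_ge0 ?invr_ge0 ?powR_ge0.
rewrite exprMn exprVn !rootX//; last by rewrite divr_ge0// ltW.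
(* The factor 1 + r >= 1 of N is given up here. *)
apply: le_trans hG; rewrite mulrC ler_pM2r ?invr_gt0// /N mulrAC.
by rewrite ler_peMr// ?divr_ge0 ?(ltW n0) ?(ltW r10)//; lra.
Qed.

End LowerBound.

(* In the second part p ranges over [1, +oo], and fine p^-1 is 1/p, equal to 0
   when p = +oo. *)
Theorem mainTheorem1 (R : realType) :
  (forall p : nat, (0 < p)%N -> ~~ odd p ->
     exists2 A : R, 0 < A &
       forall (n : nat) (r : R), (1 <= n)%N -> 0 <= r < 1 ->
         ((((32 `^ (p%:R^-1))^-1 * (n%:R / (1 - r)) `^ (p%:R^-1))%:E
             <= Cnr n r (Hardy p%:R%:E) (Hardy +oo))%E /\
          (Cnr n r (Hardy p%:R%:E) (Hardy +oo)
             <= (A * (n%:R / (1 - r)) `^ (p%:R^-1))%:E)%E)) /\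
  (forall p : \bar R, (1%:E <= p)%E ->
     exists2 A : R, 0 < A &
       forall (n : nat) (r : R), (1 <= n)%N -> 0 <= r < 1 ->
         (Cnr n r (Hardy p) (Hardy +oo)
            <= (A * (n%:R / (1 - r)) `^ (fine (p^-1)%E))%:E)%E).

Proof.
split=> [p p0 po|p p1].
  exists 330; first by rewrite ltr0n.
  move=> n r n1 r01; split; first exact: Cnr_lower.
  have p1 : (1%:E <= p%:R%:E :> \bar R)%E by rewrite lee_fin ler1n.
  by have := Cnr_upper p1 n1 r01; rewrite fine_invr.
exists 330; first by rewrite ltr0n.
by move=> n r n1 r01; exact: Cnr_upper.
Qed.
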